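(* Let $p \geq 1$ and $n\ge 1$. Every solution $[0,1]\ni t\mapsto h_t\in\mathcal P_n$ of the equation $\frac{d}{dt}\big(h_t^{-1}\dot h_t\big)=0$ is a metric geodesic of $(\mathcal P_n,d_{p,\mathcal P_n})$. Consequently, for all $h_0,h_1\in\mathcal P_n$, $$d_{p,\mathcal P_n}(h_0,h_1)=\bigg[\frac1n\sum_{j=1}^n|\lambda_j|^p\bigg]^{1/p},$$ where $e^{\lambda_1},\ldots,e^{\lambda_n}$ (with $\lambda_j\in\mathbb R$) are the eigenvalues of $h_0^{-1}h_1$, and therefore $(\mathcal P_n,d_{p,\mathcal P_n})$ is a geodesic metric space.
   Context: $\mathcal P_n$ is the set of positive definite Hermitian $n\times n$ matrices, a manifold with tangent space $T_h\mathcal P_n=\mathrm{Herm}_n$ (the Hermitian $n\times n$ matrices) at each $h\in\mathcal P_n$. If a matrix $A=U\,\mathrm{diag}(\mu_1,\dots,\mu_n)\,U^{-1}$ is diagonalizable with real eigenvalues and $f:\mathbb R\to\mathbb R$, then $f(A):=U\,\mathrm{diag}(f(\mu_1),\dots,f(\mu_n))\,U^{-1}$; for $h\in \mathcal P_n$ and $\nu\in\mathrm{Herm}_n$ the matrix $h^{-1}\nu$ is of this type, and $|h^{-1}\nu|^p$ is understood with $f(x)=|x|^p$. For $p\ge1$ define the Finsler structure $$\|\nu\|_{p,h}:=\Big[\frac1n\,\mathrm{tr}\big(|h^{-1}\nu|^p\big)\Big]^{1/p},\qquad \nu\in T_h\mathcal P_n,$$ and let $d_{p,\mathcal P_n}(h_0,h_1)$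 be the infimum of $\int_0^1\|\dot h_t\|_{p,h_t}\,dt$ over smooth curves $[0,1]\ni t\mapsto h_t\in\mathcal P_n$ joining $h_0$ to $h_1$. A metric geodesic of a metric space $(M,d)$ is a curve $[0,1]\ni t\mapsto g_t\in M$ with $d(g_a,g_b)=|a-b|\,d(g_0,g_1)$ for all $a,b\in[0,1]$; a geodesic metric space is one in which any two points are joined by a metric geodesic. *)

(* Defs.v *)
From HB Require Import structures.
From mathcomp Require Import all_boot all_order all_algebra.
From mathcomp Require Import complex.
From mathcomp Require Import all_classical all_reals all_analysis.
Import Order.TTheory GRing.Theory Num.Theory.
Import numFieldNormedType.Exports.

Set Implicit Arguments.
Unset Strict Implicit.
Unset Printing Implicit Defensive.

Local Open Scope classical_set_scope.
Local Open Scope ring_scope.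
Local Open Scope sesquilinear_scope.

Section PositiveDefinite.
Context (R : realType) (n : nat).
Local Notation C := R[i].

(* In the order of [R[i]], [0 < z] says that [z] is real and positive. *)
Definition posdefmx : set 'M[C]_n :=
  [set A | A \is hermsymmx /\
    forall v : 'cV[C]_n, v != 0 -> 0 < (v ^t* *m A *m v) 0 0].

Definition rdiag_mx (mu : 'rV[R]_n) : 'M[C]_n :=
  diag_mx (map_mx (real_complex R) mu).

(* The value does not depend on the chosen diagonalization; it is 0 when [A]
   is not diagonalizable with real eigenvalues. *)
Definition funmx (f : R -> R) (A : 'M[C]_n) : 'M[C]_n :=
  xget 0 [set B | exists (U : 'M[C]_n) (mu : 'rV[R]_n),
    [/\ U \in unitmx,
        A = U *m rdiag_mx mu *m invmx U &
        B = U *m rdiag_mx (map_mx f mu) *m invmx U]].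

(* For [h] positive definite and [nu] Hermitian the trace is a nonnegative
   real number; [complex.Re] only changes its type. *)
Definition finsler_norm (p : R) (h nu : 'M[C]_n) : R :=
  (n%:R^-1 * complex.Re (\tr (funmx (fun x => `|x| `^ p) (invmx h *m nu))))
    `^ p^-1.

End PositiveDefinite.

(* Derivatives of functions on the closed interval [0, 1]: they are one-sided
   at the endpoints, and values outside [0, 1] are irrelevant. *)
Section UnitIntervalCurves.
Context (R : realType).
Local Notation C := R[i].

Definition diffquo (f : R -> R) (t s : R) : R := (s - t)^-1 * (f s - f t).

Definition derivable01 (f : R -> R) (t : R) : Prop :=
  cvg (diffquo f t s @[s --> within `[0, 1] t^']).

Definition derive01 (f : R -> R) (t : R) : R :=
  lim (diffquo f t s @[s --> within `[0, 1] t^']).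

Definition mxderivable01 n (h : R -> 'M[C]_n) (t : R) : Prop :=
  forall i j, derivable01 (fun s => complex.Re (h s i j)) t /\
              derivable01 (fun s => complex.Im (h s i j)) t.

Definition mxderive01 n (h : R -> 'M[C]_n) (t : R) : 'M[C]_n :=
  \matrix_(i, j) (derive01 (fun s => complex.Re (h s i j)) t +i*
                  derive01 (fun s => complex.Im (h s i j)) t)%C.

Definition smooth01 n (h : R -> 'M[C]_n) : Prop :=
  forall (k : nat) (t : R), t \in `[0, 1] ->
    mxderivable01 (iter k (@mxderive01 n) h) t.

Definition posdef_curve n (h : R -> 'M[C]_n) : Prop :=
  forall t : R, t \in `[0, 1] -> posdefmx (h t).

Definition finsler_length n (p : R) (h : R -> 'M[C]_n) : \bar R :=
  (\int[lebesgue_measure]_(t in `[0%R, 1%R])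
     (finsler_norm p (h t) (mxderive01 h t))%:E)%E.

Definition finsler_dist n (p : R) (h0 h1 : 'M[C]_n) : \bar R :=
  ereal_inf [set l | exists h : R -> 'M[C]_n,
    [/\ smooth01 h, posdef_curve h, h 0 = h0, h 1 = h1 &
        l = finsler_length p h]].

Definition geodesic_equation n (h : R -> 'M[C]_n) : Prop :=
  let xi := fun t => invmx (h t) *m mxderive01 h t in
  forall t : R, t \in `[0, 1] ->
    [/\ mxderivable01 h t, mxderivable01 xi t & mxderive01 xi t = 0].

End UnitIntervalCurves.

(* Distances are [\bar R]-valued because [finsler_dist] is an infimum of
   integrals; finiteness is part of [is_metric_on]. *)
Section MetricSpaces.
Context (R : realType) (T : Type) (M : set T) (d : T -> T -> \bar R).

Definition is_metric_on : Prop :=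
  [/\ forall x y, M x -> M y -> d x y \is a fin_num /\ (0 <= d x y)%E,
      forall x y, M x -> M y -> (d x y = 0%E <-> x = y),
      forall x y, M x -> M y -> d x y = d y x &
      forall x y z, M x -> M y -> M z -> (d x z <= d x y + d y z)%E].

Definition metric_geodesic (g : R -> T) : Prop :=
  (forall t : R, t \in `[0, 1] -> M (g t)) /\
  forall a b : R, a \in `[0, 1] -> b \in `[0, 1] ->
    d (g a) (g b) = (`|a - b|%:E * d (g 0%R) (g 1%R))%E.

Definition geodesic_metric_space : Prop :=
  is_metric_on /\
  forall x y, M x -> M y ->
    exists g : R -> T, [/\ metric_geodesic g, g 0 = x & g 1 = y].

End MetricSpaces.

(* [lam] lists, with multiplicity, the logarithms of the eigenvalues of [A]. *)
Definition log_eigenvalues (R : realType) n (A : 'M[R[i]]_n)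
    (lam : 'I_n -> R) : Prop :=
  char_poly A = \prod_(j < n) ('X - ((expR (lam j))%:C%C)%:P).

(* Main.v *)
Require Import Defs.
From HB Require Import structures.
From mathcomp Require Import all_boot all_order all_algebra.
From mathcomp Require Import complex.
From mathcomp Require Import all_classical all_reals all_analysis.
Import Order.TTheory GRing.Theory Num.Theory.
Import numFieldNormedType.Exports.

Set Implicit Arguments.
Unset Strict Implicit.
Unset Printing Implicit Defensive.

Local Open Scope classical_set_scope.
Local Open Scope ring_scope.

(* The lower bound on lengths is a calibration. Simultaneous diagonalization
   writes [h0 = G^* G] and [h1 = G^* diag(exp lam) G]; the curve
   [G^* diag(exp (t lam)) G] has constant speed, the normalized [p]-norm of
   [lam]. Let [c] be the gradient of this norm at [lam], let [D j] be the
   pivots of [G^-* h G^-1] under Gaussian elimination, and put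
   [psi h = \sum_j c j * ln (D j)]. The derivative of [psi] at [h] in direction
   [nu] is [\sum_j c j * (S^* nu S) j j] for some [S] with [S^* h S = 1], and
   this diagonal is a doubly stochastic average of the eigenvalues of
   [h^-1 nu]; by Young's inequality the derivative is at most the Finsler norm
   of [nu]. Hence [psi b - psi a <= d a b] for all [a] and [b], with equality
   for [a = h0] and [b = h1]. Telescoping [psi] through an intermediate point
   also gives the triangle inequality, without concatenating smooth curves. *)

(** * Calibration inequality for p-norms of real vectors *)

Section WeightedNorms.
Context (R : realType) (n : nat) (p : R).
Hypothesis p1 : 1 <= p.

Let p_gt0 : 0 < p. Proof. exact: lt_le_trans p1. Qed.
Let p_neq0 : p != 0. Proof. by rewrite gt_eqF. Qed.

Lemma norm_divK (x N : R) : 0 < N -> `|x| = N * `|x / N|.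
Proof.
by move=> N0; rewrite normrM normfV (gtr0_norm N0) mulrC mulfVK ?gt_eqF.
Qed.

Definition pnorm (lam : 'I_n -> R) : R := (\sum_j `|lam j| `^ p) `^ p^-1.

(** This is the norm of the Finsler structure, read off the eigenvalues of [h^-1 nu]. It is a
    constant multiple of [pnorm], for which the estimates are proved first. *)
Definition mean_pnorm (lam : 'I_n -> R) : R :=
  (n%:R^-1 * \sum_j `|lam j| `^ p) `^ p^-1.

Lemma sum_powR_ge0 (lam : 'I_n -> R) : 0 <= \sum_j `|lam j| `^ p.
Proof. by apply: sumr_ge0 => j _; exact: powR_ge0. Qed.

Lemma mean_pnormE lam : mean_pnorm lam = n%:R^-1 `^ p^-1 * pnorm lam.
Proof. by rewrite /mean_pnorm powRM ?invr_ge0 ?ler0n ?sum_powR_ge0. Qed.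

Lemma pnorm_ge0 lam : 0 <= pnorm lam. Proof. exact: powR_ge0. Qed.

Lemma pnormX lam : pnorm lam `^ p = \sum_j `|lam j| `^ p.
Proof. by rewrite /pnorm -powRrM mulVf// powRr1// sum_powR_ge0. Qed.

Lemma pnorm_eq0 lam : pnorm lam = 0 -> forall j, lam j = 0.
Proof.
move=> /(congr1 (@powR R ^~ p)); rewrite pnormX powR0// => /eqP.
rewrite psumr_eq0 => [/allP h j|j _]; last exact: powR_ge0.
have /= := h j (mem_index_enum j).
by rewrite powR_eq0 p_neq0 andbT normr_eq0 => /eqP.
Qed.

Lemma pnormZ (a : R) lam : pnorm (fun j => a * lam j) = `|a| * pnorm lam.
Proof.
rewrite /pnorm (eq_bigr (fun j => `|a| `^ p * `|lam j| `^ p)); last first.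
  by move=> j _; rewrite normrM powRM.
rewrite -mulr_sumr powRM ?powR_ge0 ?sum_powR_ge0//.
by rewrite -powRrM mulfV// powRr1.
Qed.

Lemma eq_pnorm lam mu : lam =1 mu -> pnorm lam = pnorm mu.
Proof. by move=> e; rewrite /pnorm; under eq_bigr do rewrite e. Qed.

(** Young's inequality for the conjugate exponents [p / (p - 1)] and [p]. Written with the weights
    [1 - p^-1] and [p^-1], it still makes sense at [p = 1], where the conjugate exponent is
    infinite; there both sides reduce to [b]. *)
Lemma young_powR (a b : R) : 0 <= a -> 0 <= b ->
  a `^ (p - 1) * b <= (1 - p^-1) * a `^ p + p^-1 * b `^ p.
Proof.
move=> a0 b0; have [->|pn1] := eqVneq p 1.
  by rewrite subrr powRr0 invr1 subrr !mul1r mul0r add0r powRr1.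
have pm0 : 0 < p - 1 by rewrite subr_gt0 lt_neqAle eq_sym pn1.
have q0 : 0 < (1 - p^-1)^-1.
  by rewrite invr_gt0 subr_gt0 invf_lt1// -subr_gt0.
have := @conjugate_powR R (a `^ (p - 1)) b (1 - p^-1)^-1 p
  (powR_ge0 _ _) b0 q0 p_gt0.
rewrite invrK subrK => /(_ erefl).
rewrite -powRrM; have -> : (p - 1) / (1 - p^-1) = p.
  have -> : p - 1 = p * (1 - p^-1) by rewrite mulrBr mulr1 mulfV.
  by rewrite mulfK// -invr_eq0 gt_eqF.
by rewrite mulrC (mulrC _ (1 - _)) (mulrC _ p^-1) mulrC.
Qed.

(* The gradient of the [p]-norm at [lam], the covector calibrating the geodesic
   in the direction [lam]. *)
Definition pnorm_grad (lam : 'I_n -> R) : 'I_n -> R :=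
  fun j => Num.sg (lam j) * `|lam j / pnorm lam| `^ (p - 1).

(** Euler's identity for a function homogeneous of degree one. The zero vector is treated apart,
    because the gradient divides by the norm. *)
Lemma pnorm_grad_self lam : \sum_j pnorm_grad lam j * lam j = pnorm lam.
Proof.
have [N0|N0] := eqVneq (pnorm lam) 0.
  rewrite big1; first by rewrite N0.
  by move=> j _; rewrite (pnorm_eq0 N0) mulr0.
have Npos : 0 < pnorm lam by rewrite lt_neqAle eq_sym N0 pnorm_ge0.
rewrite (eq_bigr (fun j => pnorm lam * (pnorm lam `^ p)^-1 * `|lam j| `^ p)).
  by rewrite -mulr_sumr -pnormX mulfVK// powR_eq0 negb_and N0.
move=> j _; rewrite /pnorm_grad mulrAC -normrEsg.
have e : `|lam j| = pnorm lam * `|lam j / pnorm lam| by exact: norm_divK.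
have powE : `|lam j| `^ p = pnorm lam `^ p * `|lam j / pnorm lam| `^ p.
  by rewrite [in LHS]e powRM// ltW.
rewrite [in LHS]e -[LHS]mulrA mulr_powRB1// powE !mulrA mulfVK//.
by rewrite powR_eq0 negb_and N0.
Qed.

(** The gradient has dual norm at most one, and a doubly stochastic average does not increase the
    [p]-norm. One application of Young's inequality to each pair [j], [k] yields both facts: row
    sums handle the terms in [lam], column sums those in [mu], and the two weights add up to one. *)
Lemma pnorm_grad_le lam mu (w : 'I_n -> 'I_n -> R) :
    (forall j k, 0 <= w j k) ->
    (forall j, \sum_k w j k = 1) -> (forall k, \sum_j w j k = 1) ->
  \sum_j pnorm_grad lam j * (\sum_k w j k * mu k) <= pnorm mu.
Proof.
move=> w0 wr wc; have [N0|N0] := eqVneq (pnorm mu) 0.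
  rewrite N0 big1// => j _; rewrite big1 ?mulr0// => k _.
  by rewrite (pnorm_eq0 N0) mulr0.
have Npos : 0 < pnorm mu by rewrite lt_neqAle eq_sym N0 pnorm_ge0.
have [L0|L0] := eqVneq (pnorm lam) 0.
  rewrite big1 ?pnorm_ge0// => j _.
  by rewrite /pnorm_grad (pnorm_eq0 L0) sgr0 !mul0r.
have Lpos : 0 < pnorm lam by rewrite lt_neqAle eq_sym L0 pnorm_ge0.
pose a j := `|lam j / pnorm lam|; pose b k := `|mu k / pnorm mu|.
have normalized nu : 0 < pnorm nu -> \sum_j `|nu j / pnorm nu| `^ p = 1.
  move=> nu0; rewrite -pnormX (@eq_pnorm _ (fun j => (pnorm nu)^-1 * nu j)).
    by rewrite pnormZ normfV gtr0_norm// mulVf ?gt_eqF// powR1.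
  by move=> j; rewrite mulrC.
have aE : \sum_j a j `^ p = 1 by exact: normalized.
have bE : \sum_j b j `^ p = 1 by exact: normalized.
(* Young's inequality is applied to the normalized vectors [a] and [b], and the factor [pnorm mu]
   restores the scale. *)
apply: (@le_trans _ _ (\sum_j \sum_k
    w j k * (pnorm mu * ((1 - p^-1) * a j `^ p + p^-1 * b k `^ p)))).
  apply: ler_sum => j _; rewrite mulr_sumr; apply: ler_sum => k _.
  rewrite mulrCA; apply: ler_wpM2l => //.
  apply: le_trans (ler_norm _) _.
  rewrite /pnorm_grad -mulrA -/(a j) [leLHS]normrM [X in _ * X]normrM.
  apply: (@le_trans _ _ (a j `^ (p - 1) * (pnorm mu * b k))).
    rewrite (ger0_norm (powR_ge0 _ _)) /b -(norm_divK _ Npos).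
    apply: ler_piMl; first by rewrite mulr_ge0 ?powR_ge0.
    by rewrite normr_sg lern1 leq_b1.
  rewrite mulrCA; apply: ler_wpM2l; first exact: pnorm_ge0.
  by apply: young_powR; exact: normr_ge0.
under eq_bigr => j _ do under eq_bigr => k _ do rewrite mulrCA mulrDr.
under eq_bigr do rewrite -mulr_sumr big_split/=.
rewrite -mulr_sumr big_split/= [X in _ * (X + _)](_ : _ = 1 - p^-1); last first.
  rewrite -[RHS]mulr1 -aE mulr_sumr; apply: eq_bigr => j _.
  by rewrite -mulr_suml wr mul1r.
rewrite exchange_big/= [X in _ * (_ + X)](_ : _ = p^-1); last first.
  rewrite -[RHS]mulr1 -bE mulr_sumr; apply: eq_bigr => k _.
  by rewrite -mulr_suml wc mul1r.
rewrite subrK mulr1; exact: lexx.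
Qed.

Lemma mean_pnormZ (a : R) lam :
  mean_pnorm (fun j => a * lam j) = `|a| * mean_pnorm lam.
Proof. by rewrite !mean_pnormE pnormZ mulrCA. Qed.

Lemma eq_mean_pnorm lam mu : lam =1 mu -> mean_pnorm lam = mean_pnorm mu.
Proof. by move=> e; rewrite /mean_pnorm; under eq_bigr do rewrite e. Qed.

Definition mean_grad (lam : 'I_n -> R) : 'I_n -> R :=
  fun j => n%:R^-1 `^ p^-1 * pnorm_grad lam j.

Lemma mean_grad_self lam : \sum_j mean_grad lam j * lam j = mean_pnorm lam.
Proof.
rewrite mean_pnormE -pnorm_grad_self mulr_sumr.
by apply: eq_bigr => j _; rewrite mulrA.
Qed.

Lemma mean_grad_le lam mu (w : 'I_n -> 'I_n -> R) :
    (forall j k, 0 <= w j k) ->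
    (forall j, \sum_k w j k = 1) -> (forall k, \sum_j w j k = 1) ->
  \sum_j mean_grad lam j * (\sum_k w j k * mu k) <= mean_pnorm mu.
Proof.
move=> w0 wr wc; rewrite mean_pnormE /mean_grad.
under eq_bigr do rewrite -mulrA.
rewrite -mulr_sumr; apply: ler_wpM2l; first exact: powR_ge0.
exact: pnorm_grad_le.
Qed.

End WeightedNorms.

(** * Spectral theorem, Gram factorization and simultaneous diagonalization *)

Section HermitianMatrices.
Local Open Scope sesquilinear_scope.
Context (R : realType).
Local Notation C := R[i].

Lemma hermsymmxP n (A : 'M[C]_n) : A \is hermsymmx <-> A^t* = A.
Proof.
split=> [/is_hermitianmxP|e]; first by rewrite expr0 scale1r => <-.
by apply/is_hermitianmxP; rewrite expr0 scale1r e.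
Qed.

Lemma trmxC_mul m n q (A : 'M[C]_(m, n)) (B : 'M[C]_(n, q)) :
  (A *m B)^t* = B^t* *m A^t*.
Proof. by rewrite trmx_mul map_mxM. Qed.

Lemma trmxC_inv n (A : 'M[C]_n) : (invmx A)^t* = invmx (A^t*).
Proof. by rewrite trmx_inv map_invmx. Qed.

Lemma unitmx_trmxC n (A : 'M[C]_n) : (A^t* \in unitmx) = (A \in unitmx).
Proof. by rewrite map_unitmx unitmx_tr. Qed.

Lemma rdiag_trmxC n (mu : 'rV[R]_n) : (rdiag_mx mu)^t* = rdiag_mx mu.
Proof.
apply/matrixP => i j; rewrite !mxE; have [->|ij] := eqVneq i j.
  by rewrite ?eqxx !mulr1n; exact: conjc_real.
by rewrite !mulr0n rmorph0.
Qed.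

Lemma rdiag_mul n (mu nu : 'rV[R]_n) :
  rdiag_mx mu *m rdiag_mx nu = rdiag_mx (\row_j (mu 0 j * nu 0 j)).
Proof.
rewrite /rdiag_mx mulmx_diag; congr diag_mx; apply/rowP => j.
by rewrite !mxE rmorphM.
Qed.

Lemma rdiag1 n : rdiag_mx (const_mx 1) = 1%:M :> 'M[C]_n.
Proof. by rewrite /rdiag_mx map_const_mx rmorph1 diag_const_mx. Qed.

Lemma rdiag_unit n (mu : 'rV[R]_n) :
  (forall j, mu 0 j != 0) -> rdiag_mx mu \in unitmx.
Proof.
move=> mu0; rewrite /rdiag_mx unitmxE det_diag unitfE; apply/prodf_neq0 => j _.
by rewrite mxE fmorph_eq0.
Qed.

Lemma trmxC_unit_mul n m (U : 'M[C]_n) (A : 'M[C]_(n, m)) :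
  U \is unitarymx -> U^t* *m (U *m A) = A.
Proof.
by move=> Uu; rewrite mulmxA -invmx_unitary// mulVmx ?unitarymx_unit// mul1mx.
Qed.

(** [Q] may be rectangular with trivial kernel, so that this also applies to the Schur complement,
    whose basis has one column less than it has rows. *)
Lemma posdefmx_congr n m (h : 'M[C]_n) (Q : 'M[C]_(n, m)) :
  posdefmx h -> (forall v : 'cV[C]_m, v != 0 -> Q *m v != 0) ->
  posdefmx (Q^t* *m h *m Q).
Proof.
move=> [/hermsymmxP hh hp] Qi; split.
  by apply/hermsymmxP; rewrite !trmxC_mul trmxCK hh mulmxA.
move=> v v0; have := hp _ (Qi _ v0).
by rewrite trmxC_mul !mulmxA.
Qed.

Lemma unitmx_mulmx_neq0 n (Q : 'M[C]_n) (v : 'cV[C]_n) :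
  Q \in unitmx -> v != 0 -> Q *m v != 0.
Proof.
move=> Qu; apply: contraNN => /eqP e.
by rewrite -[v](mulKmx Qu) e mulmx0.
Qed.

Lemma posdefmx_congr_unit n (h Q : 'M[C]_n) :
  posdefmx h -> Q \in unitmx -> posdefmx (Q^t* *m h *m Q).
Proof.
by move=> hp Qu; apply: posdefmx_congr => // v; exact: unitmx_mulmx_neq0.
Qed.

Lemma posdefmx_diag_gt0 n (h : 'M[C]_n) i : posdefmx h -> 0 < h i i.
Proof.
move=> [_ /(_ (delta_mx i 0))].
rewrite trmx_delta map_delta_mx -rowE -colE !mxE; apply.
by apply/matrix0Pn; exists i, 0; rewrite mxE !eqxx oner_neq0.
Qed.

Lemma rdiag_posdef n (mu : 'rV[R]_n) :
  (forall j, 0 < mu 0 j) -> posdefmx (rdiag_mx mu).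
Proof.
move=> mu0; split; first by apply/hermsymmxP; exact: rdiag_trmxC.
move=> v /matrix0Pn[i [j]]; rewrite (ord1 j) => vi.
have E : (v^t* *m rdiag_mx mu *m v) 0 0 = \sum_k (mu 0 k)%:C%C * `|v k 0| ^+ 2.
  rewrite mul_mx_diag !mxE; apply: eq_bigr => k _.
  by rewrite !mxE normCKC mulrAC mulrC.
have ge k : 0 <= (mu 0 k)%:C%C * `|v k 0| ^+ 2.
  by rewrite mulr_ge0 ?exprn_ge0// ler0c ltW.
rewrite E (bigD1 i)//= ltr_pwDl ?sumr_ge0//.
by rewrite mulr_gt0 ?exprn_gt0 ?normr_gt0// (ltcR 0).
Qed.

(** The spectral theorem for normal matrices provides a complex diagonal; it is real because [A] is
    Hermitian, so taking real parts loses nothing. *)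
Lemma hermsymmx_spectral n (A : 'M[C]_n) : A \is hermsymmx ->
  exists (V : 'M[C]_n) (mu : 'rV[R]_n),
    V \is unitarymx /\ A = V^t* *m rdiag_mx mu *m V.
Proof.
move=> Ah; exists (spectralmx A), (map_mx (@complex.Re R) (spectral_diag A)).
split; first exact: spectral_unitarymx.
have dE : map_mx (real_complex R) (map_mx (@complex.Re R) (spectral_diag A)) =
    spectral_diag A.
  apply/rowP => j; rewrite !mxE [LHS]RRe_real//.
  by have /mxOverP := hermitian_spectral_diag_real Ah; exact.
have /orthomx_spectralP AE := hermitian_normalmx Ah.
by rewrite /rdiag_mx dE [LHS]AE (invmx_unitary (spectral_unitarymx A)).
Qed.

(** In [h = V^* diag(mu) V] the [mu j] are positive, being diagonal entries of a matrix congruent to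
    [h]. One takes [G = diag(sqrt mu) V]. *)
Lemma posdefmx_factor n (h : 'M[C]_n) : posdefmx h ->
  exists2 G : 'M[C]_n, G \in unitmx & h = G^t* *m G.
Proof.
move=> hp; have [V [mu [Vu hE]]] := hermsymmx_spectral hp.1.
have VtV : V^t* *m V = 1%:M.
  by rewrite -(invmx_unitary Vu) mulVmx// (unitarymx_unit Vu).
have muE : rdiag_mx mu = (V^t*)^t* *m h *m V^t*.
  rewrite hE trmxCK !mulmxA; move/unitarymxP: (Vu) => ->.
  by rewrite mul1mx -mulmxA; move/unitarymxP: (Vu) => ->; rewrite mulmx1.
have mu0 j : 0 < mu 0 j.
  have : posdefmx (rdiag_mx mu).
    rewrite muE; apply: posdefmx_congr_unit => //.
    by rewrite unitmx_trmxC (unitarymx_unit Vu).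
  by move=> /(@posdefmx_diag_gt0 _ _ j); rewrite !mxE eqxx mulr1n (ltcR 0).
exists (rdiag_mx (map_mx Num.sqrt mu) *m V).
  rewrite unitmx_mul (unitarymx_unit Vu) andbT; apply: rdiag_unit => j.
  by rewrite mxE gt_eqF// sqrtr_gt0.
rewrite trmxC_mul rdiag_trmxC mulmxA -[_ *m _ *m rdiag_mx _]mulmxA rdiag_mul.
rewrite hE; congr (_ *m rdiag_mx _ *m _); apply/rowP => j.
by rewrite !mxE -expr2 sqr_sqrtr// ltW.
Qed.

Lemma posdefmx_unit n (h : 'M[C]_n) : posdefmx h -> h \in unitmx.
Proof.
by move=> /posdefmx_factor[G Gu ->]; rewrite unitmx_mul unitmx_trmxC Gu.
Qed.

(** Write [h = G0^* G0] and diagonalize the Hermitian matrix [G0^-* nu G0^-1] by a unitary [V].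
    Replacing [G0] by [V G0] does not change the Gram matrix [h]. *)
Lemma simultaneous_diag n (h nu : 'M[C]_n) :
  posdefmx h -> nu \is hermsymmx ->
  exists (G : 'M[C]_n) (mu : 'rV[R]_n),
    [/\ G \in unitmx, h = G^t* *m G & nu = G^t* *m rdiag_mx mu *m G].
Proof.
move=> /posdefmx_factor[G0 G0u hE] /hermsymmxP nuh.
pose X := (invmx G0)^t* *m nu *m invmx G0.
have Xh : X \is hermsymmx.
  by apply/hermsymmxP; rewrite /X !trmxC_mul trmxCK nuh mulmxA.
have [V [mu [Vu XE]]] := hermsymmx_spectral Xh.
exists (V *m G0), mu; split.
- by rewrite unitmx_mul (unitarymx_unit Vu).
- by rewrite hE trmxC_mul -mulmxA trmxC_unit_mul.
rewrite trmxC_mul !mulmxA -[_ *m V^t* *m _]mulmxA -[_ *m _ *m V]mulmxA -XE.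
rewrite /X trmxC_inv !mulmxA mulmxV ?unitmx_trmxC// mul1mx.
by rewrite mulmxKV.
Qed.

(** Positivity of [h1] makes the relative eigenvalues positive, so they have real logarithms. *)
Lemma posdef_simultaneous_diag n (h0 h1 : 'M[C]_n) :
  posdefmx h0 -> posdefmx h1 ->
  exists (G : 'M[C]_n) (lam : 'rV[R]_n),
    [/\ G \in unitmx, h0 = G^t* *m G &
        h1 = G^t* *m rdiag_mx (map_mx expR lam) *m G].
Proof.
move=> p0 p1; have [G [mu [Gu h0E h1E]]] := simultaneous_diag p0 p1.1.
have mu0 j : 0 < mu 0 j.
  have : posdefmx (rdiag_mx mu).
    rewrite (_ : rdiag_mx mu = (invmx G)^t* *m h1 *m invmx G).
      by apply: posdefmx_congr_unit; rewrite ?unitmx_inv.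
    rewrite h1E trmxC_inv !mulmxA mulVmx ?unitmx_trmxC// mul1mx.
    by rewrite mulmxK.
  by move=> /(@posdefmx_diag_gt0 _ _ j); rewrite !mxE eqxx mulr1n (ltcR 0).
exists G, (map_mx (@ln R) mu); split; [exact: Gu|exact: h0E|].
rewrite h1E (_ : map_mx expR _ = mu); first exact: erefl.
by apply/rowP => j; rewrite !mxE lnK ?posrE.
Qed.

End HermitianMatrices.

(** * The Finsler norm in terms of eigenvalues *)

Section FinslerNorm.
Local Open Scope sesquilinear_scope.
Context (R : realType).
Local Notation C := R[i].

Lemma char_poly_conj n (U A : 'M[C]_n) : U \in unitmx ->
  char_poly (U *m A *m invmx U) = char_poly A.
Proof.
move=> Uu; have UE : map_mx polyC U *m map_mx polyC (invmx U) = 1%:M.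
  by rewrite -map_mxM mulmxV// map_mx1.
rewrite /char_poly (_ : char_poly_mx _ =
    map_mx polyC U *m char_poly_mx A *m map_mx polyC (invmx U)).
  by rewrite !det_mulmx mulrAC -det_mulmx UE det1 mul1r.
rewrite /char_poly_mx mulmxBr mulmxBl scalar_mxC -(mulmxA 'X%:M) UE mulmx1.
by rewrite !map_mxM.
Qed.

Lemma char_poly_rdiag n (mu : 'rV[R]_n) :
  char_poly (rdiag_mx mu : 'M[C]_n) = \prod_j ('X - ((mu 0 j)%:C%C)%:P).
Proof.
rewrite char_poly_trig ?diag_mx_is_trig//.
by apply: eq_bigr => j _; rewrite !mxE eqxx mulr1n.
Qed.

(** By unique factorization both families list the same roots up to a permutation. This is how a
    value is shown not to depend on the chosen diagonalization or on the order of the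
    eigenvalues. *)
Lemma sum_eq_of_prod_XsubC n (a b : 'I_n -> R) (f : R -> R) :
  \prod_j ('X - ((a j)%:C%C)%:P) = \prod_j ('X - ((b j)%:C%C)%:P) ->
  \sum_j f (a j) = \sum_j f (b j).
Proof.
move=> e; pose s (c : 'I_n -> R) := [seq (c j)%:C%C | j <- index_enum 'I_n].
have /prod_XsubC_eq st : \prod_(x <- s a) ('X - x%:P) =
    \prod_(x <- s b) ('X - x%:P) by rewrite !big_map.
have sE c : \sum_j f (c j) = \sum_(x <- s c) f (complex.Re x).
  by rewrite big_map.
by rewrite !sE (perm_big _ st).
Qed.

Lemma sum_eq_of_prod_XsubC_exp n (a b : 'I_n -> R) (f : R -> R) :
  \prod_j ('X - ((expR (a j))%:C%C)%:P) =
    \prod_j ('X - ((expR (b j))%:C%C)%:P) ->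
  \sum_j f (a j) = \sum_j f (b j).
Proof.
move=> /(sum_eq_of_prod_XsubC (fun x => f (ln x))).
by under eq_bigr do rewrite expRK; under [in RHS]eq_bigr do rewrite expRK.
Qed.

(** [funmx] picks an unspecified diagonalization of its argument. Any two have the same
    characteristic polynomial, hence the same eigenvalues with multiplicity, and the trace only sees
    these. *)
Lemma trace_funmx n (f : R -> R) (U : 'M[C]_n) (mu : 'rV[R]_n) :
  U \in unitmx ->
  \tr (funmx f (U *m rdiag_mx mu *m invmx U)) = (\sum_j f (mu 0 j))%:C%C.
Proof.
move=> Uu; rewrite /funmx; set P := [set B | _].
have /(@xgetPex _ 0)[V [nu [Vu AE ->]]] : exists B, P B.
  by exists (U *m rdiag_mx (map_mx f mu) *m invmx U), U, mu.
rewrite mxtrace_mulC mulmxA mulVmx// mul1mx mxtrace_diag.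
rewrite (@sum_eq_of_prod_XsubC _ _ (fun j => nu 0 j)).
  rewrite rmorph_sum/=; apply: eq_bigr => j _; by rewrite !mxE.
by rewrite -!char_poly_rdiag -(char_poly_conj _ Uu) AE char_poly_conj.
Qed.

Lemma invmx_gram_mul n (G D : 'M[C]_n) : G \in unitmx ->
  invmx (G^t* *m G) *m (G^t* *m D *m G) = invmx G *m D *m G.
Proof.
move=> Gu; have Gtu : G^t* \in unitmx by rewrite unitmx_trmxC.
have -> : G^t* *m D *m G = (G^t* *m G) *m (invmx G *m D *m G).
  by rewrite !mulmxA mulmxK.
by rewrite mulKmx// unitmx_mul Gtu.
Qed.

Lemma finsler_normE n (p : R) (G : 'M[C]_n) (mu : 'rV[R]_n) : G \in unitmx ->
  finsler_norm p (G^t* *m G) (G^t* *m rdiag_mx mu *m G) =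
  mean_pnorm p (fun j => mu 0 j).
Proof.
move=> Gu; rewrite /finsler_norm invmx_gram_mul// -{2}(invmxK G).
by rewrite trace_funmx ?unitmx_inv.
Qed.

(* The matrices [S^* nu S] with [S^* h S = 1] are unitarily conjugate to the
   eigenvalue matrix of [h^-1 nu], so their diagonal is a doubly stochastic
   average of these eigenvalues. *)
Lemma finsler_norm_calibrated n (p : R) (lam : 'I_n -> R) (h nu S : 'M[C]_n) :
    1 <= p -> posdefmx h -> nu \is hermsymmx -> S^t* *m h *m S = 1%:M ->
  \sum_j mean_grad p lam j * complex.Re ((S^t* *m nu *m S) j j) <=
  finsler_norm p h nu.
Proof.
move=> p1 hp nuh; have [G [mu [Gu -> ->]]] := simultaneous_diag hp nuh => SE.
rewrite finsler_normE//; have [V VE] : exists V, V = G *m S by eexists.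
have VV : V^t* *m V = 1%:M by rewrite -SE VE trmxC_mul !mulmxA.
have VVt : V *m V^t* = 1%:M by exact: mulmx1C.
(* [V = G S] is unitary because [S^* h S = 1]. The weights are [|V k j|^2]: the unit columns of [V]
   give the sums over [k], its unit rows those over [j]. *)
pose w j k := complex.Re ((V k j)^* * V k j).
have wC j k : (w j k)%:C%C = (V k j)^* * V k j.
  by rewrite /w RRe_real// mulrC -normCK rpredX ?normr_real.
have -> : \sum_j mean_grad p lam j * complex.Re
      ((S^t* *m (G^t* *m rdiag_mx mu *m G) *m S) j j) =
    \sum_j mean_grad p lam j * (\sum_k w j k * mu 0 k).
  apply: eq_bigr => j _; congr (_ * _).
  have -> : S^t* *m (G^t* *m rdiag_mx mu *m G) *m S =
      V^t* *m rdiag_mx mu *m V by rewrite VE trmxC_mul !mulmxA.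
  apply: complexI; rewrite rmorph_sum/= RRe_real.
    rewrite mul_mx_diag mxE; apply: eq_bigr => k _.
    by rewrite !mxE rmorphM/= wC mulrAC.
  rewrite mul_mx_diag mxE; apply: rpred_sum => k _.
  by rewrite !mxE mulrAC -wC -rmorphM; apply/complex_realP; eexists.
apply: mean_grad_le => //.
- move=> j k; rewrite -(ler0c (w j k)) wC mulrC -normCK exprn_ge0//.
- move=> j; apply: complexI; rewrite rmorph_sum rmorph1.
  have /matrixP/(_ j j) := VV; rewrite !mxE eqxx mulr1n => e; rewrite -[RHS]e.
  by apply: eq_bigr => k _ /=; rewrite wC !mxE.
move=> k; apply: complexI; rewrite rmorph_sum rmorph1.
have /matrixP/(_ k k) := VVt; rewrite !mxE eqxx mulr1n => e; rewrite -[RHS]e.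
by apply: eq_bigr => j _ /=; rewrite wC !mxE mulrC.
Qed.

End FinslerNorm.

(** * Differential calculus on the closed unit interval *)

Section UnitIntervalCalculus.
Context (R : realType).
Implicit Types f g : R -> R.

Definition cont01 f := {within `[0%R, 1%R]%classic, continuous f}.

Lemma cont01P f : cont01 f <->
  forall t : R, t \in `[0, 1] -> f @ within `[0%R, 1%R]%classic (nbhs t) --> f t.
Proof. by split=> [/subspace_continuousP|h]; [|apply/subspace_continuousP]. Qed.

(** The derivative is two-sided and asked for in the interior only; at the endpoints continuity of
    [f] and [f'] takes over. This is the form in which the mean value theorem and the fundamental
    theorem of calculus apply. *)
Definition C1_01 f f' :=
  [/\ cont01 f, cont01 f' & forall t : R, t \in `]0, 1[ -> is_derive t 1 f (f' t)].

Lemma itv01oo (t : R) : t \in `]0, 1[ -> t \in `[0, 1].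
Proof. exact: subset_itv_oo_cc. Qed.

Lemma near01 f g (t : R) : (forall s : R, s \in `[0, 1] -> f s = g s) ->
  t \in `]0, 1[ -> {near t, f =1 g}.
Proof.
move=> fg t01; near=> s; apply: fg; apply: itv01oo.
by near: s; exact: near_in_itvoo.
Unshelve. all: by end_near. Qed.

Lemma eq_cont01 f g : (forall s : R, s \in `[0, 1] -> f s = g s) ->
  cont01 f -> cont01 g.
Proof.
move=> fg /cont01P cf; apply/cont01P => t t01; rewrite -fg//.
apply: cvg_trans (cf t t01); apply: near_eq_cvg.
by near=> s; apply: fg; near: s; exact: withinT.
Unshelve. all: by end_near. Qed.

Lemma eq_C1_01 f g f' g' : (forall s : R, s \in `[0, 1] -> f s = g s) ->
  (forall s : R, s \in `[0, 1] -> f' s = g' s) -> C1_01 f f' -> C1_01 g g'.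
Proof.
move=> fg fg' [cf cf' df]; split; [exact: eq_cont01 cf|exact: eq_cont01 cf'|].
move=> t t01; rewrite -fg' ?itv01oo//.
by apply: near_eq_is_derive (df t t01); exact: near01.
Qed.

Lemma cont01_cst (a : R) : cont01 (fun=> a).
Proof. by apply/cont01P => t _; exact: cvg_cst. Qed.

Lemma cont01D f g : cont01 f -> cont01 g -> cont01 (fun t => f t + g t).
Proof.
move=> /cont01P cf /cont01P cg; apply/cont01P => t t01.
by apply: cvgD; [exact: cf|exact: cg].
Qed.

Lemma cont01N f : cont01 f -> cont01 (fun t => - f t).
Proof.
by move=> /cont01P cf; apply/cont01P => t t01; apply: cvgN; exact: cf.
Qed.

Lemma cont01M f g : cont01 f -> cont01 g -> cont01 (fun t => f t * g t).
Proof.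
move=> /cont01P cf /cont01P cg; apply/cont01P => t t01.
by apply: cvgM; [exact: cf|exact: cg].
Qed.

Lemma cont01V f : (forall t : R, t \in `[0, 1] -> f t != 0) -> cont01 f ->
  cont01 (fun t => (f t)^-1).
Proof.
move=> f0 /cont01P cf; apply/cont01P => t t01.
by apply: cvgV; [exact: f0|exact: cf].
Qed.

Lemma cont01_ln f : (forall t : R, t \in `[0, 1] -> 0 < f t) -> cont01 f ->
  cont01 (fun t => ln (f t)).
Proof.
move=> f0 /cont01P cf; apply/cont01P => t t01.
exact: (continuous_cvg _ (continuous_ln (f0 t t01)) (cf t t01)).
Qed.

Lemma C1_01_cst (a : R) : C1_01 (fun=> a) (fun=> 0).
Proof.
split; [exact: cont01_cst|exact: cont01_cst|move=> t _].
exact: is_derive_cst.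
Qed.

Lemma C1_01D f g f' g' : C1_01 f f' -> C1_01 g g' ->
  C1_01 (fun t => f t + g t) (fun t => f' t + g' t).
Proof.
move=> [cf cf' df] [cg cg' dg]; split; [exact: cont01D|exact: cont01D|].
by move=> t t01; have := is_deriveD (df t t01) (dg t t01).
Qed.

Lemma C1_01N f f' : C1_01 f f' -> C1_01 (fun t => - f t) (fun t => - f' t).
Proof.
move=> [cf cf' df]; split; [exact: cont01N|exact: cont01N|].
by move=> t t01; have := is_deriveN (df t t01).
Qed.

Lemma C1_01M f g f' g' : C1_01 f f' -> C1_01 g g' ->
  C1_01 (fun t => f t * g t) (fun t => f' t * g t + f t * g' t).
Proof.
move=> [cf cf' df] [cg cg' dg]; split; first exact: cont01M.
  by apply: cont01D; exact: cont01M.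
move=> t t01; have := is_deriveM (df t t01) (dg t t01).
by move/is_derive_eq; apply; rewrite addrC /GRing.scale/= (mulrC (g t)).
Qed.

Lemma C1_01V f f' : (forall t : R, t \in `[0, 1] -> f t != 0) -> C1_01 f f' ->
  C1_01 (fun t => (f t)^-1) (fun t => - (f' t * (f t)^-1 * (f t)^-1)).
Proof.
move=> f0 [cf cf' df]; split; first exact: cont01V.
  have cV := cont01V f0 cf.
  by apply: cont01N; apply: cont01M => //; exact: cont01M.
move=> t t01; have := is_deriveV (f0 t (itv01oo t01)) (df t t01).
move/is_derive_eq; apply.
by rewrite /GRing.scale/= mulNr expr2 invfM mulrC mulrA.
Qed.

Lemma C1_01_ln f f' : (forall t : R, t \in `[0, 1] -> 0 < f t) -> C1_01 f f' ->
  C1_01 (fun t => ln (f t)) (fun t => f' t / f t).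
Proof.
move=> f0 [cf cf' df]; split; first exact: cont01_ln.
  by apply: cont01M => //; apply: cont01V => // t /f0/lt0r_neq0.
move=> t t01; have := is_derive1_comp (is_derive1_ln (f0 t (itv01oo t01)))
  (df t t01).
by rewrite mulrC.
Qed.

Lemma is_derive_expMr (a t : R) :
  is_derive t 1 (fun s => expR (s * a)) (expR (t * a) * a).
Proof.
have dl : is_derive t 1 (fun s : R => s * a) a.
  have := is_deriveM (is_derive_id t 1) (is_derive_cst a t 1).
  by move/is_derive_eq; apply; rewrite scaler0 add0r /GRing.scale/= mulr1.
exact: is_derive1_comp (is_derive_expR _) dl.
Qed.

Lemma C1_01_exp (a : R) :
  C1_01 (fun t => expR (t * a)) (fun t => expR (t * a) * a).
Proof.
have ce : cont01 (fun t => expR (t * a)).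
  apply: continuous_subspaceT => t; apply: differentiable_continuous.
  by apply/derivable1_diffP; case: (is_derive_expMr a t).
split=> //; first by apply: cont01M => //; exact: cont01_cst.
by move=> t _; exact: is_derive_expMr.
Qed.

Lemma C1_01_eq0 f : C1_01 f (fun=> 0) -> forall t : R, t \in `[0, 1] -> f t = f 0.
Proof.
move=> [cf _ df] t; rewrite in_itv/= => /andP[t0 t1].
have dfx x : x \in `]0, t[ -> is_derive x 1 f 0.
  rewrite in_itv/= => /andP[x0 xt]; apply: df.
  by rewrite in_itv/= x0 (lt_le_trans xt).
have cfx : {within `[0, t], continuous f}.
  apply: continuous_subspaceW cf => x/=; rewrite !in_itv/= => /andP[-> xt].
  exact: le_trans xt t1.
have [s _] := MVT_segment t0 dfx cfx.
by rewrite mul0r => /eqP; rewrite subr_eq0 => /eqP.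
Qed.

(** Every point of the unit interval is an accumulation point of it, which makes limits of
    difference quotients unique. A point at most [1/2] is approached from the right, any other from
    the left. *)
Lemma within01_proper (t : R) : t \in `[0, 1] ->
  ProperFilter (within `[0%R, 1%R]%classic t^').
Proof.
rewrite in_itv/= => /andP[t0 t1]; apply: Build_ProperFilter => -[e /= e0 te].
have [th|th] := leP t 2^-1.
- pose d := Num.min (e / 2) 2^-1.
  have d0 : 0 < d by rewrite lt_min divr_gt0 ?invr_gt0 ?ltr0n.
  have de : d < e.
    by rewrite /d gt_min ltr_pdivrMr// ltr_pMr// ltr1n.
  have d2 : d <= 2^-1 by rewrite /d ge_min lexx orbT.
  apply: (te (t + d)); rewrite /ball/=.
  + by rewrite opprD addrA subrr sub0r normrN gtr0_norm.
  + by rewrite addrC -subr_eq0 addrK gt_eqF.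
  + rewrite in_itv/= addr_ge0 ?(ltW d0)//= (le_trans (lerD th d2))//.
    by rewrite -div1r -splitr.
pose d := Num.min (e / 2) 2^-1.
have d0 : 0 < d by rewrite lt_min divr_gt0 ?invr_gt0 ?ltr0n.
have de : d < e by rewrite /d gt_min ltr_pdivrMr// ltr_pMr// ltr1n.
have d2 : d <= 2^-1 by rewrite /d ge_min lexx orbT.
apply: (te (t - d)); rewrite /ball/=.
- by rewrite opprB addrC subrK gtr0_norm.
- by rewrite -subr_eq0 addrAC subrr sub0r oppr_eq0 gt_eqF.
by rewrite in_itv/= subr_ge0 (le_trans d2 (ltW th))//= lerBlDr ler_wpDr// ltW.
Qed.

Definition has_derive01 f (t l : R) :=
  diffquo f t s @[s --> within `[0%R, 1%R]%classic t^'] --> l.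

Lemma has_derive01_derivable f t l : has_derive01 f t l -> derivable01 f t.
Proof. by move=> h; apply/cvg_ex; exists l. Qed.

Lemma has_derive01E f t l : t \in `[0, 1] -> has_derive01 f t l ->
  derive01 f t = l.
Proof.
move=> t01 h; apply: (@cvg_lim) => //; exact: within01_proper.
Qed.

Lemma derivable01_has f t : derivable01 f t -> has_derive01 f t (derive01 f t).
Proof. by []. Qed.

Lemma eq_has_derive01 f g (t : R) l : (forall s : R, s \in `[0, 1] -> f s = g s) ->
  t \in `[0, 1] -> has_derive01 f t l -> has_derive01 g t l.
Proof.
move=> fg t01 h; apply: cvg_trans h; apply: near_eq_cvg; near=> s.
rewrite /diffquo !fg//.
by near: s; exact: withinT.
Unshelve. all: by end_near. Qed.

Lemma has_derive01N f t a :
  has_derive01 f t a -> has_derive01 (fun s => - f s) t (- a).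
Proof.
move=> fa; rewrite /has_derive01.
rewrite (_ : diffquo _ t = (fun s => - diffquo f t s)); first exact: cvgN fa.
by apply/funext => s; rewrite /diffquo -mulrN opprB opprK [- f s + _]addrC.
Qed.

(** Caratheodory's slope function is continuous at [t] and equals the difference quotient away from
    [t]. *)
Lemma is_derive_has01 f (t l : R) : is_derive t 1 f l -> has_derive01 f t l.
Proof.
move=> /is_derive1_caratheodory[g [gE cg <-]].
apply: cvg_within_filter.
apply: (@cvg_trans _ (g @ t^')); last by apply: cvg_within_filter.
apply: near_eq_cvg; near=> s.
rewrite /diffquo gE mulrC mulfK// subr_eq0.
by near: s; exact: nbhs_dnbhs_neq.
Unshelve. all: by end_near. Qed.

(** Differentiability implies continuity, through [f s = f t + (s - t) * diffquo f t s]. The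
    difference quotient has a limit along the punctured neighborhoods, so the point [s = t] is added
    back separately. *)
Lemma has_derive01_within f (t l : R) : has_derive01 f t l ->
  f @ within `[0%R, 1%R]%classic (nbhs t) --> f t.
Proof.
move=> h; have lim0 : (fun s => (s - t) * diffquo f t s) @
    within `[0%R, 1%R]%classic t^' --> (t - t) * l.
  apply: cvgM => //; apply: cvgB; last exact: cvg_cst.
  by apply: cvg_within_filter; exact: cvg_within.
have : (fun s => f t + (s - t) * diffquo f t s) @
    within `[0%R, 1%R]%classic t^' --> f t.
  rewrite -[X in _ --> X]addr0 -[X in _ + X](mul0r l) -[X in _ + X * _](subrr t).
  by apply: cvgD => //; exact: cvg_cst.
move=> h1 V Vft.
have n1 : nbhs t (fun s => s != t -> `[0%R, 1%R]%classic s ->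
    V (f t + (s - t) * diffquo f t s)) := h1 V Vft.
suff : nbhs t (fun s => `[0%R, 1%R]%classic s -> V (f s)) by [].
apply: filterS n1 => s sV s01; have [->|st] := eqVneq s t.
  exact: nbhs_singleton.
have -> : f s = f t + (s - t) * diffquo f t s.
  by rewrite /diffquo mulVKf ?subr_eq0// addrC subrK.
exact: sV.
Qed.


End UnitIntervalCalculus.

(** * Continuously differentiable complex and matrix-valued curves *)

Section MatrixCurves.
Local Open Scope sesquilinear_scope.
Context (R : realType).
Local Notation C := R[i].

(** Near an interior point the restriction to the unit interval is void. The Caratheodory slope is
    the difference quotient, completed by [l] at [t]. *)
Lemma has_derive01_is_derive (f : R -> R) (t l : R) : t \in `]0, 1[ ->
  has_derive01 f t l -> is_derive t 1 f l.
Proof.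
move=> t01 h; apply/is_derive1_caratheodory.
exists (fun z => if z == t then l else diffquo f t z); split.
- move=> z; have [->|zt] := eqVneq z t; first by rewrite !subrr mulr0.
  by rewrite /diffquo mulrC mulVKf// subr_eq0.
- rewrite /prop_for /continuous_at eqxx => V Vl.
  have n1 : nbhs t (fun s => s != t -> `[0%R, 1%R]%classic s ->
    V (diffquo f t s)) := h V Vl.
  suff : nbhs t (fun s => V (if s == t then l else diffquo f t s)) by [].
  near=> s; have [_|st] := eqVneq s t; first exact: nbhs_singleton Vl.
  have s01 : `[0%R, 1%R]%classic s.
    by apply: itv01oo; near: s; exact: near_in_itvoo.
  move: st s01; near: s; exact: n1.
- by rewrite eqxx.
Unshelve. all: by end_near. Qed.

Lemma derivable01_cont (f : R -> R) :
  (forall t : R, t \in `[0, 1] -> derivable01 f t) -> cont01 f.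
Proof.
move=> df; apply/cont01P => t t01.
exact: has_derive01_within (derivable01_has (df t t01)).
Qed.

Lemma derivable01_C1 (f : R -> R) :
  (forall t : R, t \in `[0, 1] -> derivable01 f t) -> cont01 (derive01 f) ->
  C1_01 f (derive01 f).
Proof.
move=> df cf'; split=> //; first exact: derivable01_cont.
move=> t t01; apply: has_derive01_is_derive => //.
exact: derivable01_has (df t (itv01oo t01)).
Qed.

Definition cC1_01 (f f' : R -> C) :=
  C1_01 (fun t => complex.Re (f t)) (fun t => complex.Re (f' t)) /\
  C1_01 (fun t => complex.Im (f t)) (fun t => complex.Im (f' t)).

Lemma ReM (x y : C) : complex.Re (x * y) =
  complex.Re x * complex.Re y - complex.Im x * complex.Im y.
Proof. by case: x; case: y. Qed.

Lemma ImM (x y : C) : complex.Im (x * y) =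
  complex.Re x * complex.Im y + complex.Im x * complex.Re y.
Proof. by case: x; case: y. Qed.

Lemma ReD (x y : C) : complex.Re (x + y) = complex.Re x + complex.Re y.
Proof. by case: x; case: y. Qed.

Lemma ImD (x y : C) : complex.Im (x + y) = complex.Im x + complex.Im y.
Proof. by case: x; case: y. Qed.

Lemma ReN (x : C) : complex.Re (- x) = - complex.Re x.
Proof. by case: x. Qed.

Lemma ImN (x : C) : complex.Im (- x) = - complex.Im x.
Proof. by case: x. Qed.

Lemma eq_cC1_01 (f f' g g' : R -> C) :
  (forall s : R, s \in `[0, 1] -> f s = g s) ->
  (forall s : R, s \in `[0, 1] -> f' s = g' s) -> cC1_01 f f' -> cC1_01 g g'.
Proof.
move=> fg fg' [fr fi].
by split; [apply: eq_C1_01 fr|apply: eq_C1_01 fi] => s s01; rewrite ?fg ?fg'.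
Qed.

Lemma cC1_01_cst (a : C) : cC1_01 (fun=> a) (fun=> 0).
Proof. by split; exact: C1_01_cst. Qed.

Lemma cC1_01_real (f f' : R -> R) : C1_01 f f' ->
  cC1_01 (fun t => (f t)%:C%C) (fun t => (f' t)%:C%C).
Proof. by move=> ff'; split=> //=; exact: C1_01_cst. Qed.

Lemma cC1_01D (f g f' g' : R -> C) : cC1_01 f f' -> cC1_01 g g' ->
  cC1_01 (fun t => f t + g t) (fun t => f' t + g' t).
Proof.
move=> [fr fi] [gr gi]; split.
  by apply: eq_C1_01 (C1_01D fr gr) => t _; rewrite ReD.
by apply: eq_C1_01 (C1_01D fi gi) => t _; rewrite ImD.
Qed.

Lemma cC1_01N (f f' : R -> C) : cC1_01 f f' ->
  cC1_01 (fun t => - f t) (fun t => - f' t).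
Proof.
move=> [fr fi]; split.
  by apply: eq_C1_01 (C1_01N fr) => t _; rewrite ReN.
by apply: eq_C1_01 (C1_01N fi) => t _; rewrite ImN.
Qed.

Lemma cC1_01M (f g f' g' : R -> C) : cC1_01 f f' -> cC1_01 g g' ->
  cC1_01 (fun t => f t * g t) (fun t => f' t * g t + f t * g' t).
Proof.
move=> [fr fi] [gr gi]; split.
  apply: eq_C1_01 (C1_01D (C1_01M fr gr) (C1_01N (C1_01M fi gi))) => t _.
    by rewrite ReM.
  by rewrite ReD !ReM opprD addrACA.
apply: eq_C1_01 (C1_01D (C1_01M fr gi) (C1_01M fi gr)) => t _.
  by rewrite ImM.
by rewrite ImD !ImM addrACA.
Qed.

Lemma cC1_01_sum (I : Type) (s : seq I) (f f' : I -> R -> C) :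
  (forall k, cC1_01 (f k) (f' k)) ->
  cC1_01 (fun t => \sum_(k <- s) f k t) (fun t => \sum_(k <- s) f' k t).
Proof.
move=> ff'; elim: s => [|k s IH].
  by apply: eq_cC1_01 (cC1_01_cst 0) => t _; rewrite big_nil.
by apply: eq_cC1_01 (cC1_01D (ff' k) IH) => t _; rewrite big_cons.
Qed.

Definition mC1_01 m n (h h' : R -> 'M[C]_(m, n)) :=
  forall i j, cC1_01 (fun t => h t i j) (fun t => h' t i j).

Lemma eq_mC1_01 m n (f f' g g' : R -> 'M[C]_(m, n)) :
  (forall s : R, s \in `[0, 1] -> f s = g s) ->
  (forall s : R, s \in `[0, 1] -> f' s = g' s) -> mC1_01 f f' -> mC1_01 g g'.
Proof.
move=> fg fg' h i j; apply: eq_cC1_01 (h i j) => s s01; first by rewrite fg.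
by rewrite fg'.
Qed.

Lemma mC1_01_cst m n (A : 'M[C]_(m, n)) : mC1_01 (fun=> A) (fun=> 0).
Proof.
by move=> i j; apply: eq_cC1_01 (cC1_01_cst (A i j)) => t _; rewrite ?mxE.
Qed.

Lemma mC1_01B m n (f g f' g' : R -> 'M[C]_(m, n)) :
  mC1_01 f f' -> mC1_01 g g' ->
  mC1_01 (fun t => f t - g t) (fun t => f' t - g' t).
Proof.
move=> ff' gg' i j; apply: eq_cC1_01 (cC1_01D (ff' i j) (cC1_01N (gg' i j))).
  by move=> t _; rewrite !mxE.
by move=> t _; rewrite !mxE.
Qed.

Lemma mC1_01M m n q (f f' : R -> 'M[C]_(m, n)) (g g' : R -> 'M[C]_(n, q)) :
  mC1_01 f f' -> mC1_01 g g' ->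
  mC1_01 (fun t => f t *m g t) (fun t => f' t *m g t + f t *m g' t).
Proof.
move=> ff' gg' i j.
apply: eq_cC1_01 (cC1_01_sum (index_enum 'I_n)
  (fun k => cC1_01M (ff' i k) (gg' k j))).
  by move=> t _; rewrite mxE.
by move=> t _; rewrite !mxE big_split.
Qed.

Lemma mC1_01_cstMl m n q (A : 'M[C]_(m, n)) (g g' : R -> 'M[C]_(n, q)) :
  mC1_01 g g' -> mC1_01 (fun t => A *m g t) (fun t => A *m g' t).
Proof.
move=> gg'; apply: eq_mC1_01 (mC1_01M (mC1_01_cst A) gg') => // t _.
by rewrite mul0mx add0r.
Qed.

Lemma mC1_01_cstMr m n q (f f' : R -> 'M[C]_(m, n)) (A : 'M[C]_(n, q)) :
  mC1_01 f f' -> mC1_01 (fun t => f t *m A) (fun t => f' t *m A).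
Proof.
move=> ff'; apply: eq_mC1_01 (mC1_01M ff' (mC1_01_cst A)) => // t _.
by rewrite mulmx0 addr0.
Qed.

Lemma mC1_01Z m n (a a' : R -> C) (g g' : R -> 'M[C]_(m, n)) :
  cC1_01 a a' -> mC1_01 g g' ->
  mC1_01 (fun t => a t *: g t) (fun t => a' t *: g t + a t *: g' t).
Proof.
move=> aa' gg' i j; apply: eq_cC1_01 (cC1_01M aa' (gg' i j)) => t _.
  by rewrite mxE.
by rewrite !mxE.
Qed.

Lemma mxderivable01_C1 n (h : R -> 'M[C]_n) :
  (forall t : R, t \in `[0, 1] -> mxderivable01 h t) ->
  (forall i j, cont01 (fun t => complex.Re (mxderive01 h t i j)) /\
               cont01 (fun t => complex.Im (mxderive01 h t i j))) ->
  mC1_01 h (mxderive01 h).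
Proof.
move=> dh ch i j; have [cr ci] := ch i j; split.
- have E : (fun t => complex.Re (mxderive01 h t i j)) =
    derive01 (fun s => complex.Re (h s i j)).
    by apply/funext => t; rewrite mxE.
  by rewrite E; apply: derivable01_C1; [move=> t /dh/(_ i j)[]|rewrite -E].
- have E : (fun t => complex.Im (mxderive01 h t i j)) =
    derive01 (fun s => complex.Im (h s i j)).
    by apply/funext => t; rewrite mxE.
  by rewrite E; apply: derivable01_C1; [move=> t /dh/(_ i j)[]|rewrite -E].
Qed.

Lemma mxderivable01_cont n (h : R -> 'M[C]_n) i j :
  (forall t : R, t \in `[0, 1] -> mxderivable01 h t) ->
  cont01 (fun t => complex.Re (h t i j)) /\
  cont01 (fun t => complex.Im (h t i j)).
Proof.
by move=> dh; split; apply: derivable01_cont => t /dh/(_ i j)[].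
Qed.

(** Derivability of [h] provides the derivative, and derivability of [mxderive01 h] its
    continuity. *)
Lemma smooth01_C1 n (h : R -> 'M[C]_n) : smooth01 h ->
  mC1_01 h (mxderive01 h).
Proof.
move=> sh; apply: mxderivable01_C1; first exact: (sh 0%N).
by move=> i j; apply: mxderivable01_cont; exact: (sh 1%N).
Qed.

Definition has_mxderive01 n (h : R -> 'M[C]_n) (t : R) (L : 'M[C]_n) :=
  forall i j,
    has_derive01 (fun s => complex.Re (h s i j)) t (complex.Re (L i j)) /\
    has_derive01 (fun s => complex.Im (h s i j)) t (complex.Im (L i j)).

Lemma has_mxderive01_derivable n (h : R -> 'M[C]_n) (t : R) (L : 'M[C]_n) :
  has_mxderive01 h t L -> mxderivable01 h t.
Proof.
move=> hL i j; have [hr hi] := hL i j.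
by split; [exact: has_derive01_derivable hr|exact: has_derive01_derivable hi].
Qed.

Lemma has_mxderive01E n (h : R -> 'M[C]_n) (t : R) (L : 'M[C]_n) :
  t \in `[0, 1] -> has_mxderive01 h t L -> mxderive01 h t = L.
Proof.
move=> t01 hL; apply/matrixP => i j; have [hr hi] := hL i j.
by rewrite mxE (has_derive01E t01 hr) (has_derive01E t01 hi); case: (L i j).
Qed.

Lemma eq_has_mxderive01 n (h k : R -> 'M[C]_n) (t : R) (L : 'M[C]_n) :
  (forall s : R, s \in `[0, 1] -> h s = k s) -> t \in `[0, 1] ->
  has_mxderive01 h t L -> has_mxderive01 k t L.
Proof.
move=> hk t01 hL i j; have [hr hi] := hL i j.
by split; [apply: eq_has_derive01 hr|apply: eq_has_derive01 hi] => // s s01;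
   rewrite hk.
Qed.

(** Entries in transposed positions are conjugate along the curve, and this passes to the limit of
    the difference quotients, at the endpoints as well. *)
Lemma mxderive01_herm n (h : R -> 'M[C]_n) (t : R) : posdef_curve h ->
  t \in `[0, 1] -> mxderivable01 h t -> mxderive01 h t \is hermsymmx.
Proof.
move=> ph t01 dh; apply/hermsymmxP.
have hh (s : R) i j : s \in `[0, 1] -> h s j i = ((h s i j)^*)%C.
  by move=> /ph[/hermsymmxP e _]; rewrite -{1}e !mxE.
apply/matrixP => i j; rewrite !mxE.
have [hr hi] := dh i j.
have hr' : has_derive01 (fun s => complex.Re (h s j i)) t
    (derive01 (fun s => complex.Re (h s i j)) t).
  apply: eq_has_derive01 t01 hr => s s01.
  by rewrite (hh s i j)//; case: (h s i j).
have hi' : has_derive01 (fun s => complex.Im (h s j i)) t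
    (- derive01 (fun s => complex.Im (h s i j)) t).
  apply: eq_has_derive01 t01 (has_derive01N hi) => s s01.
  by rewrite (hh s i j)//; case: (h s i j).
rewrite (has_derive01E t01 hr') (has_derive01E t01 hi').
exact: (congr1 (Complex _) (opprK _)).
Qed.

End MatrixCurves.

(** * Schur complements and the potential built from the pivots *)

Section PivotPotential.
Local Open Scope sesquilinear_scope.
Context (R : realType).
Local Notation C := R[i].

Section Schur.
Context (n : nat).
Implicit Types A X : 'M[C]_(1 + n).

Definition corner A : R := complex.Re (A 0 0).

Definition schur A : 'M[C]_n :=
  drsubmx A - ((corner A)^-1)%:C%C *: (dlsubmx A *m ursubmx A).

(** The columns form a basis of the [A]-orthogonal complement of the first coordinate vector: for
    positive definite [A] the first row of [A *m schur_basis A] vanishes. *)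
Definition schur_basis A : 'M[C]_(1 + n, n) :=
  col_mx (- ((corner A)^-1)%:C%C *: ursubmx A) 1%:M.

Lemma hermsymmx_corner A : A \is hermsymmx -> A 0 0 = (corner A)%:C%C.
Proof.
move=> /hermsymmxP e; rewrite /corner RRe_real//; apply/CrealP.
by rewrite -[in RHS]e !mxE.
Qed.

Lemma corner_gt0 A : posdefmx A -> 0 < corner A.
Proof.
move=> Ap; rewrite -(ltcR 0) -hermsymmx_corner ?Ap.1//.
exact: posdefmx_diag_gt0.
Qed.

Lemma hermsymmx_block A : A \is hermsymmx ->
  A = block_mx (corner A)%:C%C%:M (ursubmx A) ((ursubmx A)^t*)
      (drsubmx A).
Proof.
move=> Ah; rewrite -{1}[A]submxK; congr block_mx.
  rewrite [LHS]mx11_scalar !mxE; congr (_%:M).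
  by rewrite -hermsymmx_corner//; congr (A _ _); apply/val_inj.
apply/matrixP => i j; rewrite !mxE.
by have /hermsymmxP/matrixP/(_ (rshift 1 i) (lshift n j)) := Ah; rewrite !mxE.
Qed.

Lemma schur_basis_trmxC A : (schur_basis A)^t* =
  row_mx (- ((corner A)^-1)%:C%C *: (ursubmx A)^t*) 1%:M.
Proof.
rewrite /schur_basis tr_col_mx map_row_mx trmx1 map_mx1; congr row_mx.
apply/matrixP => i j; rewrite !mxE rmorphM rmorphN/=; congr (- _ * _).
exact: conjc_real.
Qed.

Lemma mul_schur_basis A : posdefmx A ->
  A *m schur_basis A = col_mx 0 (schur A).
Proof.
move=> Ap; have Ah := Ap.1; have a0 := corner_gt0 Ap.
rewrite [in X in X *m _](hermsymmx_block Ah) /schur_basis mul_block_col.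
rewrite !mulmx1 mul_scalar_mx scalerA mulrN -rmorphM/= mulfV ?gt_eqF//.
rewrite rmorph1 scaleN1r addNr; congr col_mx.
rewrite addrC -scalemxAr scaleNr /schur; congr (_ - _ *: (_ *m _)).
apply/matrixP => i j; rewrite !mxE.
by have /hermsymmxP/matrixP/(_ (rshift 1 i) (lshift n j)) := Ah; rewrite !mxE.
Qed.

(** The Schur complement is the form [A] restricted to the complement spanned by [schur_basis A],
    from which it inherits positivity. *)
Lemma schur_congr A : posdefmx A ->
  (schur_basis A)^t* *m A *m schur_basis A = schur A.
Proof.
move=> Ap; rewrite -mulmxA mul_schur_basis// schur_basis_trmxC mul_row_col.
by rewrite mulmx0 add0r mul1mx.
Qed.

Lemma schur_basis_neq0 A (v : 'cV[C]_n) : v != 0 -> schur_basis A *m v != 0.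
Proof.
apply: contraNN; rewrite /schur_basis mul_col_mx mul1mx => /eqP e.
by rewrite -[v](col_mxKd (- ((corner A)^-1)%:C%C *: ursubmx A *m v)) e
  linear0.
Qed.

Lemma posdefmx_schur A : posdefmx A -> posdefmx (schur A).
Proof.
move=> Ap; rewrite -schur_congr//; apply: posdefmx_congr => // v.
exact: schur_basis_neq0.
Qed.

Lemma schur_scalar (x y : R) :
  - y%:C%C * (x%:C%C * - y%:C%C) = (x * y * y)%:C%C.
Proof. by rewrite mulNr !mulrN opprK mulrCA mulrA !rmorphM. Qed.

(** Expanded so that, for [A = h] and [X = h'], the terms are those of the Leibniz rule for
    [schur h]. *)
Lemma schur_basis_congr A X : X \is hermsymmx -> A \is hermsymmx ->
  (schur_basis A)^t* *m X *m schur_basis A =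
  drsubmx X +
  (corner X * (corner A)^-1 * (corner A)^-1)%:C%C *: (dlsubmx A *m ursubmx A) -
  ((corner A)^-1)%:C%C *: (dlsubmx X *m ursubmx A) -
  ((corner A)^-1)%:C%C *: (dlsubmx A *m ursubmx X).
Proof.
move=> Xh Ah; rewrite schur_basis_trmxC.
have dlA : dlsubmx A = (ursubmx A)^t*.
  by rewrite {1}(hermsymmx_block Ah) block_mxKdl.
have dlX : dlsubmx X = (ursubmx X)^t*.
  by rewrite {1}(hermsymmx_block Xh) block_mxKdl.
rewrite {1}(hermsymmx_block Xh) mul_row_block /schur_basis mul_row_col.
rewrite !mulmx1 !mul1mx -dlA -dlX.
rewrite mul_mx_scalar scalerA -!scalemxAl -!scalemxAr mulmxDl.
rewrite -!scalemxAl scalerDr scalerA schur_scalar !scaleNr.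
by rewrite addrA [LHS]addrC !addrA.
Qed.

(** In the derivative of [B^* h B] with [B = schur_basis h], the variation of [B] contributes
    nothing: it lives in the first coordinate, where [h B] vanishes. The proof checks this by
    comparing the Leibniz rule on the blocks with [schur_basis_congr]. *)
Lemma schur_C1 (h h' : R -> 'M[C]_(1 + n)) : mC1_01 h h' ->
  (forall t : R, t \in `[0, 1] -> posdefmx (h t)) ->
  (forall t : R, t \in `[0, 1] -> h' t \is hermsymmx) ->
  mC1_01 (fun t => schur (h t))
    (fun t => (schur_basis (h t))^t* *m h' t *m schur_basis (h t)).
Proof.
move=> hh' hp hh.
have dcorner : C1_01 (fun t => corner (h t)) (fun t => corner (h' t)).
  by have [] := hh' 0 0.
have dinv : C1_01 (fun t => (corner (h t))^-1)
    (fun t => - (corner (h' t) * (corner (h t))^-1 * (corner (h t))^-1)).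
  by apply: C1_01V => // t /hp/corner_gt0/lt0r_neq0.
have ddl : mC1_01 (fun t => dlsubmx (h t)) (fun t => dlsubmx (h' t)).
  move=> i j; apply: eq_cC1_01 (hh' (rshift 1 i) (lshift n j)) => t _;
    by rewrite !mxE.
have dur : mC1_01 (fun t => ursubmx (h t)) (fun t => ursubmx (h' t)).
  move=> i j; apply: eq_cC1_01 (hh' (lshift n i) (rshift 1 j)) => t _;
    by rewrite !mxE.
have ddr : mC1_01 (fun t => drsubmx (h t)) (fun t => drsubmx (h' t)).
  move=> i j; apply: eq_cC1_01 (hh' (rshift 1 i) (rshift 1 j)) => t _;
    by rewrite !mxE.
apply: eq_mC1_01 (mC1_01B ddr (mC1_01Z (cC1_01_real dinv) (mC1_01M ddl dur))).
  by [].
move=> t t01; rewrite (schur_basis_congr (hh t t01) (hp t t01).1).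
by rewrite rmorphN scaleNr scalerDr !opprD opprK !addrA.
Qed.

Lemma rdiag_corner (mu : 'rV[R]_(1 + n)) :
  corner (rdiag_mx mu) = mu 0 (lshift n ord0).
Proof.
rewrite /corner !mxE eqxx mulr1n /=; congr (mu _ _); exact/val_inj.
Qed.

Lemma rdiag_schur (mu : 'rV[R]_(1 + n)) :
  schur (rdiag_mx mu) = rdiag_mx (rsubmx mu).
Proof.
have -> : schur (rdiag_mx mu) = drsubmx (rdiag_mx mu).
  rewrite /schur (_ : dlsubmx _ = 0) ?mul0mx ?scaler0 ?subr0//.
  by apply/matrixP => i j; rewrite !mxE eq_rlshift mulr0n.
by apply/matrixP => i j; rewrite !mxE (inj_eq (@rshift_inj _ _)).
Qed.

(* Gaussian elimination: a basis orthonormal for the Schur complement extends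
   to one orthonormal for [A]. *)
Lemma schur_orthonormal A (S : 'M[C]_n) : posdefmx A ->
  S^t* *m schur A *m S = 1%:M ->
  exists S1 : 'M[C]_(1 + n), S1^t* *m A *m S1 = 1%:M /\
  forall X, X \is hermsymmx ->
    (complex.Re ((S1^t* *m X *m S1) (lshift n ord0) (lshift n ord0)) =
      corner X / corner A) /\
    (forall j, (S1^t* *m X *m S1) (rshift 1 j) (rshift 1 j) =
      (S^t* *m ((schur_basis A)^t* *m X *m schur_basis A) *m S) j j).
Proof.
move=> Ap SE; have a0 := corner_gt0 Ap.
(* [u] is the first coordinate vector scaled to length one for [A], and [T] is the given orthonormal
   basis carried into the complement of [u]. The mixed blocks [uT] and [Tu] vanish, so [u] and [T]
   together are orthonormal. *)
pose r : C := (Num.sqrt (corner A))^-1%:C%C.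
have r2 : r * r = ((corner A)^-1)%:C%C.
  by rewrite /r -rmorphM -invfM -expr2 sqr_sqrtr// ltW.
pose u : 'cV[C]_(1 + n) := r *: delta_mx 0 0.
pose T := schur_basis A *m S.
have uE : u^t* = r *: delta_mx 0 0.
  rewrite /u linearZ/= map_mxZ trmx_delta map_delta_mx; congr (_ *: _).
  exact: conjc_real.
have TX X : T^t* *m X *m T =
    S^t* *m ((schur_basis A)^t* *m X *m schur_basis A) *m S.
  by rewrite /T trmxC_mul !mulmxA.
have uX X : (u^t* *m X *m u) 0 0 = ((corner A)^-1)%:C%C * X 0 0.
  rewrite uE /u -!scalemxAl -scalemxAr scalerA r2 -rowE -colE.
  by rewrite !mxE.
have uT : u^t* *m A *m T = 0.
  rewrite uE -!scalemxAl -mulmxA /T (mulmxA A) mul_schur_basis// -rowE.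
  apply/rowP => j; rewrite mul_col_mx mul0mx !mxE.
  by case: splitP => k //= _; rewrite mxE mulr0.
have Tu : T^t* *m A *m u = 0.
  have /hermsymmxP Ah := Ap.1.
  have := congr1 (fun M => M^t*) uT.
  by rewrite !trmxC_mul trmxCK Ah mulmxA trmx0 map_mx0.
exists (row_mx u T); have blockE X : (row_mx u T)^t* *m X *m row_mx u T =
    block_mx (u^t* *m X *m u) (u^t* *m X *m T) (T^t* *m X *m u)
      (T^t* *m X *m T).
  by rewrite tr_row_mx map_col_mx mul_col_mx mul_col_row.
split.
  rewrite blockE uT Tu TX schur_congr// SE.
  rewrite [u^t* *m A *m u]mx11_scalar uX (hermsymmx_corner Ap.1).
  by rewrite -rmorphM/= mulVf ?gt_eqF// rmorph1 -scalar_mx_block.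
move=> X Xh; rewrite blockE; split=> [|j]; last by rewrite block_mxEdr TX.
rewrite block_mxEul uX (hermsymmx_corner Xh) -rmorphM/=.
exact: mulrC.
Qed.

End Schur.

(* [phi A] is the sum of the [c j * ln (D j)], where the [D j] are the pivots of
   [A] under Gaussian elimination. *)
Lemma pivot_potential n (c : 'I_n -> R) : exists phi : 'M[C]_n -> R,
  (forall lam : 'rV[R]_n,
    phi (rdiag_mx (map_mx expR lam)) = \sum_j c j * lam 0 j) /\
  (forall h h' : R -> 'M[C]_n, mC1_01 h h' ->
    (forall t : R, t \in `[0, 1] -> posdefmx (h t)) ->
    (forall t : R, t \in `[0, 1] -> h' t \is hermsymmx) ->
    exists2 g : R -> R, C1_01 (fun t => phi (h t)) g &
    forall t : R, t \in `[0, 1] -> exists2 S : 'M[C]_n,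
      S^t* *m h t *m S = 1%:M &
      g t = \sum_j c j * complex.Re ((S^t* *m h' t *m S) j j)).
Proof.
elim: n c => [|n IH] c.
  exists (fun=> 0); split=> [lam|h h' _ _ _]; first by rewrite big_ord0.
  exists (fun=> 0); first exact: C1_01_cst.
  move=> t _; exists 1%:M; last by rewrite big_ord0.
  by apply/matrixP => -[].
rewrite -[n.+1]/(1 + n)%N in c *.
have [phi [phiE phiD]] := IH (fun j => c (rshift 1 j)).
(* The first pivot is the corner, and the remaining pivots of [A] are the pivots of its Schur
   complement. *)
exists (fun A : 'M[C]_(1 + n) =>
  c (lshift n ord0) * ln (corner A) + phi (schur A)); split.
  move=> lam; rewrite rdiag_corner mxE expRK rdiag_schur -map_rsubmx phiE.
  rewrite big_split_ord/= big_ord1; congr (_ + _).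
  by apply: eq_bigr => j _; rewrite mxE.
move=> h h' hh' hp hh.
have sp (t : R) : t \in `[0, 1] -> posdefmx (schur (h t)).
  by move=> /hp; exact: posdefmx_schur.
have [||g gD gE] := phiD _ _ (schur_C1 hh' hp hh); first exact: sp.
  move=> t t01; have /hermsymmxP e := hh t t01.
  by apply/hermsymmxP; rewrite !trmxC_mul trmxCK e mulmxA.
have dln : C1_01 (fun t => ln (corner (h t)))
    (fun t => corner (h' t) / corner (h t)).
  apply: C1_01_ln; first by move=> t /hp/corner_gt0.
  by have [] := hh' 0 0.
exists (fun t => c (lshift n ord0) * (corner (h' t) / corner (h t)) + g t).
  apply: C1_01D gD.
  apply: eq_C1_01 (C1_01M (C1_01_cst (c (lshift n ord0))) dln) => // t _.
  by rewrite mul0r add0r.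
move=> t t01; have [S SE gtE] := gE t t01.
have [S1 [S1E S1X]] := schur_orthonormal (hp t t01) SE.
exists S1 => //; have [e0 ej] := S1X _ (hh t t01).
rewrite big_split_ord/= big_ord1 e0 gtE; congr (_ + _).
by apply: eq_bigr => j _; rewrite ej.
Qed.

End PivotPotential.

(** * Bounding a length from below by the increment of a potential *)

Section LengthLowerBound.
Context (R : realType).

(* Unlike [ge0_le_integral], this needs no measurability: the integral of a
   nonnegative function is the supremum of those of the simple functions below
   it. *)
Lemma ge0_integral_mono d (T : measurableType d)
    (mu : {measure set T -> \bar R}) (D : set T) (f g : T -> \bar R) :
  (forall x, D x -> 0 <= f x)%E -> (forall x, D x -> f x <= g x)%E ->
  (\int[mu]_(x in D) f x <= \int[mu]_(x in D) g x)%E.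
Proof.
move=> f0 fg; rewrite !ge0_integralE//; last first.
  by move=> x Dx; apply: le_trans (f0 x Dx) (fg x Dx).
apply: ereal_sup_le => _ [k /= kf <-]; exists k => //= x.
apply: le_trans (kf x) _; rewrite /patch; case: ifP => // /set_mem.
exact: fg.
Qed.

(** The increment of [F] is the integral of [g], by the fundamental theorem. The positive part of
    [g] is inserted because [ge0_integral_mono] compares nonnegative functions. *)
Lemma C1_01_integral_ge (F g f : R -> R) : C1_01 F g ->
  (forall t : R, t \in `[0, 1] -> g t <= f t) -> (forall t, 0 <= f t) ->
  ((F 1 - F 0)%:E <=
    \int[lebesgue_measure]_(t in `[0%R, 1%R]) (f t)%:E)%E.
Proof.
move=> [cF cg dF] gf f0.
have FLR : derivable_oo_LRcontinuous F 0 1.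
  have [_ F0 F1] := (continuous_within_itvP F ltr01).1 cF.
  by split=> // x x01; case: (dF x x01).
have F'g : {in `]0, 1[, derive1 F =1 g}.
  by move=> x x01; rewrite derive1E; case: (dF x x01).
rewrite EFinB -(continuous_FTC2 ltr01 cg FLR F'g) integralE.
apply: (@le_trans _ _ (\int[lebesgue_measure]_(t in `[0%R, 1%R])
    ((fun t => (g t)%:E)^\+ t)))%E.
  by rewrite -[leRHS]sube0 leeB ?integral_ge0.
apply: ge0_integral_mono => t; first by move=> _; exact: funepos_ge0.
move=> t01; rewrite funeposE ge_max !lee_fin f0 gf//.
Qed.

End LengthLowerBound.

(** * The calibrating function and the length of exponential curves *)

Section ExponentialCurves.
Local Open Scope sesquilinear_scope.
Context (R : realType) (n : nat) (p : R).
Hypothesis p1 : 1 <= p.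
Local Notation C := R[i].
Implicit Types (G : 'M[C]_n) (lam : 'rV[R]_n).

Lemma eq_gram_rdiag G (a b : 'rV[R]_n) : (forall l, a 0 l = b 0 l) ->
  G^t* *m rdiag_mx a *m G = G^t* *m rdiag_mx b *m G.
Proof. by move=> /rowP ->. Qed.

Lemma gramE G : G^t* *m G = G^t* *m rdiag_mx (const_mx 1) *m G.
Proof. by rewrite rdiag1 mulmx1. Qed.

(** [psi] is the pivot potential with weights [mean_grad], read in the frame [G]. The last bound
    covers all pairs of matrices: unless both are positive definite, no curve joins them and the
    infimum is [+oo]. *)
Lemma finsler_dist_potential G lam : G \in unitmx ->
  exists psi : 'M[C]_n -> R,
    [/\ psi (G^t* *m G) = 0,
        psi (G^t* *m rdiag_mx (map_mx expR lam) *m G) =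
          mean_pnorm p (fun j => lam 0 j) &
        forall h0 h1, ((psi h1 - psi h0)%:E <= finsler_dist p h0 h1)%E].
Proof.
move=> Gu; pose P : 'M[C]_n := invmx G.
have Gtu : G^t* \in unitmx by rewrite unitmx_trmxC.
have PK D : P^t* *m (G^t* *m D *m G) *m P = D.
  rewrite /P trmxC_inv !mulmxA mulVmx// mul1mx.
  by rewrite mulmxK.
have [phi [phiE phiD]] := pivot_potential (mean_grad p (fun j => lam 0 j)).
exists (fun h => phi (P^t* *m h *m P)); split.
(* The identity is the diagonal matrix of exponentials of the zero vector. *)
- rewrite gramE PK (_ : const_mx 1 = map_mx expR 0 :> 'rV[R]_n).
    by rewrite phiE big1// => j _; rewrite mxE mulr0.
  by apply/rowP => j; rewrite !mxE expR0.
- by rewrite PK phiE mean_grad_self.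
move=> h0 h1; apply: le_ereal_inf_tmp => _ [h [sh hp <- <- ->]].
have hC1 := smooth01_C1 sh.
have hh (t : R) : t \in `[0, 1] -> mxderive01 h t \is hermsymmx.
  by move=> t01; apply: mxderive01_herm => //; exact: (sh 0%N).
have Pu : P \in unitmx by rewrite unitmx_inv.
have [|||g gD gE] := phiD (fun t => P^t* *m h t *m P)
    (fun t => P^t* *m mxderive01 h t *m P).
- by apply: mC1_01_cstMr; exact: mC1_01_cstMl.
- by move=> t /hp ht; exact: posdefmx_congr_unit.
- move=> t /hh /hermsymmxP e.
  by apply/hermsymmxP; rewrite !trmxC_mul trmxCK e mulmxA.
apply: C1_01_integral_ge gD _ _ => t; last exact: powR_ge0.
move=> t01; have [S SE ->] := gE t t01.
(* If [S] is orthonormal for [P^* h P], then [P S] is orthonormal for [h], as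
   [finsler_norm_calibrated] requires. *)
have E X : S^t* *m (P^t* *m X *m P) *m S = (P *m S)^t* *m X *m (P *m S).
  by rewrite trmxC_mul !mulmxA.
under eq_bigr do rewrite E.
apply: finsler_norm_calibrated => //; [exact: hp|exact: hh|].
by rewrite -E.
Qed.

Lemma is_derive_expsum (a mu : 'I_n -> R) (k : nat) (t : R) :
  is_derive t 1 (fun t => \sum_l a l * (mu l ^+ k * expR (t * mu l)))
    (\sum_l a l * (mu l ^+ k.+1 * expR (t * mu l))).
Proof.
have dl l : is_derive t 1 (fun t => a l * (mu l ^+ k * expR (t * mu l)))
    (a l * (mu l ^+ k.+1 * expR (t * mu l))).
  have := is_deriveZ (a l * mu l ^+ k) (is_derive_expMr (mu l) t).
  rewrite (_ : _ \*: _ = (fun t => a l * (mu l ^+ k * expR (t * mu l)))).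
    move/is_derive_eq; apply.
    by rewrite /GRing.scale/= exprSr -!mulrA (mulrC (expR _)).
  by apply/funext => s; rewrite /= /GRing.scale/= mulrA.
by have := is_derive_sum dl; rewrite fct_sumE.
Qed.

(** The [k]-th derivative of [G^* diag(exp (t lam)) G]. Indexing by the order of derivation keeps
    all iterated derivatives in one family. *)
Definition expcurve G lam (k : nat) (t : R) : 'M[C]_n :=
  G^t* *m rdiag_mx (\row_l (lam 0 l ^+ k * expR (t * lam 0 l))) *m G.

Lemma expcurve_entry G lam k t i j : expcurve G lam k t i j =
  \sum_l (G^t* i l * G l j) * (lam 0 l ^+ k * expR (t * lam 0 l))%:C%C.
Proof.
rewrite /expcurve /rdiag_mx mul_mx_diag mxE; apply: eq_bigr => l _.
by rewrite !mxE mulrAC.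
Qed.

Lemma expcurve_has_mxderive01 G lam k t :
  has_mxderive01 (expcurve G lam k) t (expcurve G lam k.+1 t).
Proof.
have ReS (F : 'I_n -> C) (x : 'I_n -> R) :
    complex.Re (\sum_l F l * (x l)%:C%C) = \sum_l complex.Re (F l) * x l.
  elim/big_rec2: _ => [//|l y z _ <-].
  by rewrite ReD ReM/= mulr0 subr0.
have ImS (F : 'I_n -> C) (x : 'I_n -> R) :
    complex.Im (\sum_l F l * (x l)%:C%C) = \sum_l complex.Im (F l) * x l.
  elim/big_rec2: _ => [//|l y z _ <-].
  by rewrite ImD ImM/= mulr0 add0r.
move=> i j; rewrite expcurve_entry ReS ImS; split.
  rewrite (_ : (fun s => _) = (fun s => \sum_l complex.Re (G^t* i l * G l j) *
      (lam 0 l ^+ k * expR (s * lam 0 l)))).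
    by apply: is_derive_has01; exact: is_derive_expsum.
  by apply/funext => s; rewrite expcurve_entry ReS.
rewrite (_ : (fun s => _) = (fun s => \sum_l complex.Im (G^t* i l * G l j) *
    (lam 0 l ^+ k * expR (s * lam 0 l)))).
  by apply: is_derive_has01; exact: is_derive_expsum.
by apply/funext => s; rewrite expcurve_entry ImS.
Qed.

Lemma iter_mxderive01_expcurve G lam k (t : R) : t \in `[0, 1] ->
  iter k (@mxderive01 R n) (expcurve G lam 0) t = expcurve G lam k t.
Proof.
elim: k t => [//|k IH] t t01 /=; apply: has_mxderive01E => //.
apply: eq_has_mxderive01 (expcurve_has_mxderive01 G lam k t) => // s s01.
by rewrite IH.
Qed.

Lemma smooth01_expcurve G lam : smooth01 (expcurve G lam 0).
Proof.
move=> k t t01; apply: (@has_mxderive01_derivable _ _ _ _ (expcurve G lam k.+1 t)).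
apply: eq_has_mxderive01 (expcurve_has_mxderive01 G lam k t) => // s s01.
by rewrite iter_mxderive01_expcurve.
Qed.

(** A frame along the exponential curve: at time [t] the curve is the Gram matrix of this frame, and
    its velocity is [diag(lam)] in it. Hence the speed is constant. *)
Definition moving_frame G lam (t : R) : 'M[C]_n :=
  rdiag_mx (\row_l expR (t * lam 0 l / 2)) *m G.

Lemma moving_frame_unit G lam t : G \in unitmx ->
  moving_frame G lam t \in unitmx.
Proof.
move=> Gu; rewrite unitmx_mul Gu andbT; apply: rdiag_unit => j.
by rewrite mxE gt_eqF ?expR_gt0.
Qed.

Lemma moving_frame_congr G lam t (mu : 'rV[R]_n) :
  (moving_frame G lam t)^t* *m rdiag_mx mu *m moving_frame G lam t =
  G^t* *m rdiag_mx (\row_l (mu 0 l * expR (t * lam 0 l))) *m G.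
Proof.
rewrite /moving_frame trmxC_mul rdiag_trmxC !mulmxA.
rewrite -(mulmxA _ (rdiag_mx _) (rdiag_mx mu)) rdiag_mul.
rewrite -(mulmxA _ (rdiag_mx _) (rdiag_mx _)) rdiag_mul.
apply: eq_gram_rdiag => l; rewrite !mxE.
by rewrite mulrAC -expRD -splitr mulrC.
Qed.

Lemma expcurveE G lam t : expcurve G lam 0 t =
  (moving_frame G lam t)^t* *m moving_frame G lam t.
Proof.
rewrite gramE moving_frame_congr.
by apply: eq_gram_rdiag => l; rewrite !mxE.
Qed.

Lemma posdef_gram G : G \in unitmx -> posdefmx (G^t* *m G).
Proof.
move=> Gu; rewrite gramE; apply: posdefmx_congr_unit => //.
by apply: rdiag_posdef => j; rewrite mxE.
Qed.

Lemma finsler_length_expcurve G lam : G \in unitmx ->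
  finsler_length p (expcurve G lam 0) = (mean_pnorm p (fun j => lam 0 j))%:E.
Proof.
move=> Gu; rewrite /finsler_length.
rewrite (@eq_integral _ _ _ _ _ (cst (mean_pnorm p (fun j => lam 0 j))%:E)).
  have len1 : lebesgue_measure (`[0%R, 1%R]%classic : set R) = 1%E.
    by rewrite lebesgue_measure_itv/= lte_fin ltr01 sube0.
  by rewrite integral_cst// [X in (_ * X)%E]len1 mule1.
move=> t /set_mem/= t01; congr EFin.
rewrite (has_mxderive01E t01 (expcurve_has_mxderive01 G lam 0 t)) expcurveE.
rewrite (_ : expcurve G lam 1 t = (moving_frame G lam t)^t* *m rdiag_mx lam *m
    moving_frame G lam t); first by rewrite finsler_normE// moving_frame_unit.
by rewrite moving_frame_congr.
Qed.

(** The exponential curve gives the upper bound, the calibrating function the lower one. *)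
Lemma finsler_dist_exp G lam : G \in unitmx ->
  finsler_dist p (G^t* *m G) (G^t* *m rdiag_mx (map_mx expR lam) *m G) =
  (mean_pnorm p (fun j => lam 0 j))%:E.
Proof.
move=> Gu; apply/eqP; rewrite eq_le; apply/andP; split.
  rewrite -(finsler_length_expcurve lam Gu); apply: ereal_inf_lbound.
  exists (expcurve G lam 0); split; last by [].
  - exact: smooth01_expcurve.
  - by move=> t _; rewrite expcurveE; apply/posdef_gram/moving_frame_unit.
  - by rewrite gramE; apply: eq_gram_rdiag => l; rewrite !mxE mul0r expR0 mul1r.
  - by apply: eq_gram_rdiag => l; rewrite !mxE !mul1r.
have [psi [psi0 psi1 psiD]] := finsler_dist_potential lam Gu.
by have := psiD (G^t* *m G) (G^t* *m rdiag_mx (map_mx expR lam) *m G);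
   rewrite psi0 psi1 subr0.
Qed.

End ExponentialCurves.

(** * Solutions of the geodesic equation are exponential curves *)

Section GeodesicEquation.
Local Open Scope sesquilinear_scope.
Context (R : realType) (n : nat).
Local Notation C := R[i].
Implicit Types (G : 'M[C]_n) (lam : 'rV[R]_n).

Lemma mC1_01_eq0 m q (f : R -> 'M[C]_(m, q)) : mC1_01 f (fun=> 0) ->
  forall t : R, t \in `[0, 1] -> f t = f 0.
Proof.
move=> f0 t t01; apply/matrixP => i j; have [fr fi] := f0 i j.
have {}fr : C1_01 (fun t => complex.Re (f t i j)) (fun=> 0).
  by apply: eq_C1_01 fr => // s _; rewrite mxE.
have {}fi : C1_01 (fun t => complex.Im (f t i j)) (fun=> 0).
  by apply: eq_C1_01 fi => // s _; rewrite mxE.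
have := C1_01_eq0 fi t01; have := C1_01_eq0 fr t01.
by case: (f t i j) (f 0 i j) => a b [c d] /= -> ->.
Qed.

(** Continuity of the velocity of a solution comes from the equation itself, which turns the
    velocity into [h t *m X] with [X] constant. *)
Lemma cont01_mulmx_cst (h : R -> 'M[C]_n) (X : 'M[C]_n) i j :
  (forall i j, cont01 (fun t => complex.Re (h t i j)) /\
               cont01 (fun t => complex.Im (h t i j))) ->
  cont01 (fun t => complex.Re ((h t *m X) i j)) /\
  cont01 (fun t => complex.Im ((h t *m X) i j)).
Proof.
move=> ch; suff : forall s : seq 'I_n,
    cont01 (fun t => complex.Re (\sum_(k <- s) h t i k * X k j)) /\
    cont01 (fun t => complex.Im (\sum_(k <- s) h t i k * X k j)).
  move=> /(_ (index_enum 'I_n))[cr ci].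
  by split; [apply: eq_cont01 cr|apply: eq_cont01 ci] => t _; rewrite mxE.
elim=> [|k s [cr ci]].
  by split; apply: eq_cont01 (@cont01_cst R 0) => t _; rewrite big_nil.
have [hr hi] := ch i k; have cX a := @cont01_cst R a.
split.
  apply: eq_cont01 (cont01D (cont01D (cont01M hr (cX (complex.Re (X k j))))
    (cont01N (cont01M hi (cX (complex.Im (X k j)))))) cr) => t _.
  by rewrite big_cons ReD ReM.
apply: eq_cont01 (cont01D (cont01D (cont01M hr (cX (complex.Im (X k j))))
  (cont01M hi (cX (complex.Re (X k j))))) ci) => t _.
by rewrite big_cons ImD ImM.
Qed.

Lemma rdiag_exp_C1 (mu : 'rV[R]_n) :
  mC1_01 (fun t => rdiag_mx (\row_l expR (t * mu 0 l)))
    (fun t => rdiag_mx mu *m rdiag_mx (\row_l expR (t * mu 0 l))).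
Proof.
move=> i j; have [ij|ij] := eqVneq i j; last first.
  apply: eq_cC1_01 (cC1_01_cst 0) => t _.
    by rewrite !mxE (negbTE ij) mulr0n.
  by rewrite rdiag_mul !mxE (negbTE ij) mulr0n.
apply: eq_cC1_01 (cC1_01_real (C1_01_exp (mu 0 j))) => t _.
  by rewrite !mxE ij eqxx mulr1n.
by rewrite rdiag_mul !mxE ij eqxx mulr1n mulrC.
Qed.

(* The logarithmic derivative [h^-1 h'] is constant, hence equal to
   [G^-1 diag(lam) G] for a simultaneous diagonalization of [h 0] and [h' 0];
   then [h t G^-1 diag(exp (- t lam))] has derivative zero. *)
Lemma geodesic_equation_expcurve (h : R -> 'M[C]_n) :
  posdef_curve h -> geodesic_equation h ->
  exists G lam, G \in unitmx /\
    forall t : R, t \in `[0, 1] -> h t = expcurve G lam 0 t.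
Proof.
move=> hp; rewrite /geodesic_equation.
set xi := (fun t => invmx (h t) *m mxderive01 h t) => ge.
have i0 : (0 : R) \in `[0, 1] by rewrite in_itv/= lexx ler01.
have dh (t : R) : t \in `[0, 1] -> mxderivable01 h t by move=> /ge[].
have dxi (t : R) : t \in `[0, 1] -> mxderivable01 xi t by move=> /ge[].
have xi0 (t : R) : t \in `[0, 1] -> mxderive01 xi t = 0 by move=> /ge[].
have xiE : forall t : R, t \in `[0, 1] -> xi t = xi 0.
  apply: mC1_01_eq0; apply: eq_mC1_01 (mxderivable01_C1 dxi _) => // i j.
  by split; apply: eq_cont01 (@cont01_cst R 0) => t t01; rewrite xi0// mxE.
have h'E (t : R) : t \in `[0, 1] -> mxderive01 h t = h t *m xi 0.
  by move=> t01; rewrite -(xiE t t01) /xi mulKVmx// posdefmx_unit//; exact: hp.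
(* With a constant logarithmic derivative the equation becomes the linear one [h' = h X], whose
   right-hand side is continuous. *)
have hC1 : mC1_01 h (fun t => h t *m xi 0).
  apply: eq_mC1_01 (mxderivable01_C1 dh _) => // i j.
  have [cr ci] := cont01_mulmx_cst (xi 0) i j
    (fun i j => mxderivable01_cont i j dh).
  by split; [apply: eq_cont01 cr|apply: eq_cont01 ci] => t t01; rewrite h'E.
have [G [lam [Gu h0E h'0E]]] :=
  simultaneous_diag (hp _ i0) (mxderive01_herm hp i0 (dh _ i0)).
have XE : xi 0 = invmx G *m rdiag_mx lam *m G.
  by rewrite /xi h'0E {1}h0E invmx_gram_mul.
exists G, lam; split; [exact: Gu|move=> t t01].
pose E (s : R) : 'M[C]_n := rdiag_mx (\row_l expR (s * (- lam) 0 l)).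
have kC1 : mC1_01 (fun s => h s *m invmx G *m E s) (fun=> 0).
  apply: eq_mC1_01 (mC1_01M (mC1_01_cstMr (invmx G) hC1)
    (rdiag_exp_C1 (- lam))) => // s _.
  (* Since [X G^-1 = G^-1 diag(lam)], the two terms of the product rule carry [diag(lam)] and
     [diag(- lam)] in the same place and cancel. *)
  rewrite XE !mulmxA mulmxK// -!mulmxA -!mulmxDr.
  rewrite -mulmxDl.
  rewrite (_ : rdiag_mx lam + rdiag_mx (- lam) = 0) ?mul0mx ?mulmx0//.
  by apply/matrixP => i j; rewrite !mxE -mulrnDl rmorphN subrr mul0rn.
have := mC1_01_eq0 kC1 t01; rewrite h0E (mulmxK Gu).
have -> : E 0 = 1%:M.
  by rewrite -rdiag1 /E; congr rdiag_mx; apply/rowP => l; rewrite !mxE mul0r expR0.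
rewrite mulmx1 => kE; rewrite /expcurve -kE.
rewrite -(mulmxA _ (E t)) /E rdiag_mul (_ : \row__ _ = const_mx 1).
  by rewrite rdiag1 mulmx1 mulmxKV.
by apply/rowP => l; rewrite !mxE expr0 mul1r -expRD mulrN addNr expR0.
Qed.

End GeodesicEquation.

(** * Metric axioms, geodesics and the eigenvalue formula *)

Section Metric.
Local Open Scope sesquilinear_scope.
Context (R : realType) (n : nat) (p : R).
Hypothesis p1 : 1 <= p.
Local Notation C := R[i].
Implicit Types (G : 'M[C]_n) (lam : 'rV[R]_n).

(** In the moving frame at time [a], the point at time [b] is the diagonal matrix of exponentials of
    [(b - a) lam], so the distance formula for endpoints applies to any two points of the curve. *)
Lemma finsler_dist_expcurve G lam (a b : R) : G \in unitmx ->
  finsler_dist p (expcurve G lam 0 a) (expcurve G lam 0 b) =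
  (`|a - b| * mean_pnorm p (fun j => lam 0 j))%:E.
Proof.
move=> Gu; rewrite [in X in finsler_dist _ X]expcurveE.
have -> : expcurve G lam 0 b = (moving_frame G lam a)^t* *m
    rdiag_mx (map_mx expR ((b - a) *: lam)) *m moving_frame G lam a.
  rewrite moving_frame_congr; apply: eq_gram_rdiag => l; rewrite !mxE.
  by rewrite expr0 mul1r -expRD mulrBl subrK.
rewrite finsler_dist_exp ?moving_frame_unit//; congr EFin.
rewrite distrC -(mean_pnormZ p1).
by apply: eq_mean_pnorm => j; rewrite mxE.
Qed.

Lemma expcurve_metric_geodesic G lam : G \in unitmx ->
  metric_geodesic (@posdefmx R n) (finsler_dist p) (expcurve G lam 0).
Proof.
move=> Gu; split=> [t _|a b _ _].
  by rewrite expcurveE; apply/posdef_gram/moving_frame_unit.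
rewrite !(finsler_dist_expcurve _ _ _ Gu) sub0r normrN1 mul1r.
exact: EFinM.
Qed.

Lemma expcurve0 G lam : expcurve G lam 0 0 = G^t* *m G.
Proof.
by rewrite gramE; apply: eq_gram_rdiag => l; rewrite !mxE mul0r expR0 mul1r.
Qed.

Lemma expcurve1 G lam :
  expcurve G lam 0 1 = G^t* *m rdiag_mx (map_mx expR lam) *m G.
Proof. by apply: eq_gram_rdiag => l; rewrite !mxE !mul1r. Qed.

Lemma posdef_expcurve (h0 h1 : 'M[C]_n) : posdefmx h0 -> posdefmx h1 ->
  exists G lam,
    [/\ G \in unitmx, h0 = expcurve G lam 0 0 & h1 = expcurve G lam 0 1].
Proof.
move=> p0 p1'; have [G [lam [Gu h0E h1E]]] := posdef_simultaneous_diag p0 p1'.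
by exists G, lam; rewrite expcurve0 expcurve1.
Qed.

Lemma finsler_dist_ends G lam : G \in unitmx ->
  finsler_dist p (expcurve G lam 0 0) (expcurve G lam 0 1) =
  (mean_pnorm p (fun j => lam 0 j))%:E.
Proof.
by move=> Gu; rewrite (finsler_dist_expcurve _ _ _ Gu) sub0r normrN1 mul1r.
Qed.

Lemma finsler_dist_metric : (0 < n)%N ->
  is_metric_on (@posdefmx R n) (finsler_dist p).
Proof.
move=> n0; split=> x y.
- move=> /posdef_expcurve/[apply] -[G [lam [Gu -> ->]]].
  by rewrite (finsler_dist_ends _ Gu) lee_fin powR_ge0.
- move=> xp yp; split=> [|<-].
    have [G [lam [Gu -> ->]]] := posdef_expcurve xp yp.
    rewrite (finsler_dist_ends _ Gu) => -[]; rewrite mean_pnormE => /eqP.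
    (* Positivity of [n] makes the normalizing factor nonzero, so the [p]-norm of [lam] itself
       vanishes. *)
    rewrite mulf_eq0 powR_eq0 invr_eq0 pnatr_eq0 (gtn_eqF n0)/= => /eqP N0.
    rewrite expcurve0 expcurve1 gramE; apply: eq_gram_rdiag => l.
    by rewrite !mxE (pnorm_eq0 p1 N0) expR0.
  have [G Gu ->] := posdefmx_factor xp.
  by rewrite -(expcurve0 G 0) (finsler_dist_expcurve _ _ _ Gu) subrr normr0 mul0r.
- move=> /posdef_expcurve/[apply] -[G [lam [Gu -> ->]]].
  rewrite !(finsler_dist_expcurve _ _ _ Gu) distrC; exact: erefl.
(* The function calibrating the pair [x], [z] attains their distance; its increments from [x] to [y]
   and from [y] to [z] are at most the two other distances. *)
move=> z xp yp zp; have [G [lam [Gu xE zE]]] := posdef_expcurve xp zp.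
have [psi [psi0 psi1 psiD]] := finsler_dist_potential p1 lam Gu.
rewrite {1}xE {1}zE (finsler_dist_ends _ Gu) -psi1 -expcurve1 -zE.
rewrite -[psi z]subr0 -psi0 -(expcurve0 G lam) -xE.
rewrite -(subrKA (psi y)) EFinD addeC.
by apply: leeD; exact: psiD.
Qed.

Lemma finsler_dist_geodesic_space : (0 < n)%N ->
  geodesic_metric_space (@posdefmx R n) (finsler_dist p).
Proof.
move=> n0; split; first exact: finsler_dist_metric.
move=> x y xp yp; have [G [lam [Gu xE yE]]] := posdef_expcurve xp yp.
exists (expcurve G lam 0).
split; [exact: expcurve_metric_geodesic|exact: esym xE|exact: esym yE].
Qed.

(** The matrix is similar to [diag(exp lam)], so its characteristic polynomial is the product on the
    left. *)
Lemma log_eigenvalues_expcurve G lam (mu : 'I_n -> R) : G \in unitmx ->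
  log_eigenvalues (invmx (expcurve G lam 0 0) *m expcurve G lam 0 1) mu <->
  \prod_j ('X - ((expR (lam 0 j))%:C%C)%:P) =
  \prod_j ('X - ((expR (mu j))%:C%C)%:P).
Proof.
move=> Gu; rewrite /log_eigenvalues expcurve0 expcurve1 invmx_gram_mul//.
rewrite -{2}(invmxK G) char_poly_conj ?unitmx_inv// char_poly_rdiag.
by under eq_bigr do rewrite mxE.
Qed.

End Metric.

Theorem theorem1p1 (R : realType) (p : R) (n : nat) (hp : 1 <= p)
    (hn : (1 <= n)%N) :
  [/\ forall h : R -> 'M[R[i]]_n,
        posdef_curve h -> geodesic_equation h ->
        metric_geodesic (@posdefmx R n) (finsler_dist p) h,
      forall h0 h1 : 'M[R[i]]_n, posdefmx h0 -> posdefmx h1 ->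
        (exists lam : 'I_n -> R, log_eigenvalues (invmx h0 *m h1) lam) /\
        (forall lam : 'I_n -> R, log_eigenvalues (invmx h0 *m h1) lam ->
          finsler_dist p h0 h1 =
            ((n%:R^-1 * \sum_(j < n) `|lam j| `^ p) `^ p^-1)%:E) &
      geodesic_metric_space (@posdefmx R n) (finsler_dist p)].
Proof.
split; last exact: finsler_dist_geodesic_space.
  move=> h ph /(geodesic_equation_expcurve ph)[G [lam [Gu hE]]].
  have [_ geo] := expcurve_metric_geodesic hp lam Gu.
  have i0 : (0 : R) \in `[0, 1] by rewrite in_itv/= lexx ler01.
  have i1 : (1 : R) \in `[0, 1] by rewrite in_itv/= ler01 lexx.
  by split=> // a b a01 b01; rewrite !hE//; exact: geo.
move=> h0 h1 /posdef_expcurve/[apply] -[G [lam [Gu -> ->]]]; split.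
  exists (fun j => lam 0 j); exact/(log_eigenvalues_expcurve _ _ Gu).
move=> mu /(log_eigenvalues_expcurve _ _ Gu) mulam.
rewrite (finsler_dist_ends hp _ Gu) /mean_pnorm; congr ((_ * _) `^ _)%:E.
(* [mu] is a rearrangement of [lam], and the sum of [p]-th powers is symmetric. *)
exact: (sum_eq_of_prod_XsubC_exp (fun x => `|x| `^ p) mulam).
Qed.
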